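(* Let $\mu$ be an inductive valuation on $K(x)$ equipped with a MacLane chain of length $r$, and let $\Delta=\Delta(\mu)$. With the data $\mathbb{F}_r,e_r,h_r,\lambda_r,\varphi_r(\alpha)$ attached to the chain, there is an isomorphism of graded $\mathbb{F}_r$-algebras $$\mathcal{G}r(\mu)=\bigoplus_{\alpha\in\Gamma(\mu)}\varphi_r(\alpha)\Delta\;\simeq\;\mathbb{F}_r[\mathsf y,\mathsf p,\mathsf p^{-1}][\mathsf x],$$ where $\mathsf y,\mathsf p$ are indeterminates and $\mathsf x$ is an algebraic element satisfying $\mathsf x^{e_r}=\mathsf p^{h_r}\mathsf y$. As elements of the graded algebra, these elements are homogeneous of degree $\deg \mathsf y=0$, $\deg \mathsf p=1/e(\mu_{r-1})$, $\deg \mathsf x=\lambda_r$.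
   Context: **Valuations.** $K$ is a field with a discrete valuation $v\colon K^*\to\mathbb{Z}$, $v(K^* )=\mathbb{Z}$, valuation ring $\mathcal{O}$, maximal ideal $\mathfrak m=\pi\mathcal{O}$, residue field $\mathbb{F}=\mathcal{O}/\mathfrak m$. $\mathbb{V}$ is the set of discrete valuations $\mu\colon K(x)^*\to\mathbb{Q}$ with $\mu|_K=v$, $\mu(x)\ge0$; put $\mu(0)=\infty$. $\Gamma(\mu)=\mu(K(x)^* )$, and $e(\mu)$ is the positive integer with $e(\mu)\Gamma(\mu)=\mathbb{Z}$. $\mu\le\mu'$ means $\mu(g)\le\mu'(g)$ for all $g\in K[x]$. $\mu_0\in\mathbb{V}$ is given by $\mu_0(\sum_s a_sx^s)=\min_s v(a_s)$. **Graded algebra.** For $\alpha\in\Gamma(\mu)$, $\mathcal P_\alpha=\{g\in K[x]:\mu(g)\ge\alpha\}$, $\mathcal P_\alpha^+=\{g\in K[x]:\mu(g)>\alpha\}$; $\mathcal{G}r(\mu)=\bigoplus_{\alpha\in\Gamma(\mu)}\mathcal P_\alpha/\mathcal P_\alpha^+$ (an integral domain); $\Delta(\mu)=\mathcal P_0/\mathcal P_0^+$, which is an $\mathbb{F}$-algebra. $H_\mu(0)=0$ and $H_\mu(g)=g+\mathcal P^+_{\mu(g)}$ for $g\neq0$. If $\mu\le\mu'$, there is a canonical homomorphism $\mathcal{G}r(\mu)\to\mathcal{G}r(\mu')$, sending $H_\mu(g)$ to $H_{\mu'}(g)$ if $\mu(g)=\mu'(g)$ and to $0$ otherwise. $g\sim_\mu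 h$ means $H_\mu(g)=H_\mu(h)$; $h\mid_\mu g$ means that $H_\mu(h)$ divides $H_\mu(g)$ in $\mathcal{G}r(\mu)$. **Key polynomials and augmentations.** A key polynomial for $\mu$ is a monic $\phi\in K[x]$ of positive degree such that $H_\mu(\phi)\mathcal{G}r(\mu)$ is a non-zero prime ideal and $\phi\nmid_\mu g$ for all non-zero $g$ with $\deg g<\deg\phi$. For such $\phi$ and $\lambda\in\mathbb{Q}_{>0}$, the augmented valuation $[\mu;(\phi,\lambda)]\in\mathbb V$ is $\sum_s g_s\phi^s\mapsto\min_s\{\mu(g_s\phi^s)+s\lambda\}$ on $\phi$-expansions ($\deg g_s<\deg\phi$). A valuation $\mu$ is inductive if it is obtained from $\mu_0$ by finitely many augmentations $\mu_i=[\mu_{i-1};(\phi_i,\lambda_i)]$, $1\le i\le r$, $\mu_r=\mu$. Such a chain is a MacLane chain of length $r$ if $\phi_{i+1}\not\sim_{\mu_i}\phi_i$ for $1\le i<r$. **Data of a MacLane chain.** Put $\phi_0=x$, $\lambda_0=0$, $\mu_{-1}=\mu_0$. For $0\le i\le r$: $\Delta_i=\Delta(\mu_i)$; $\mathbb{F}_0=\mathrm{Im}(\mathbb{F}\to\Delta_0)$, and $\mathbb{F}_i=\mathrm{Im}(\Delta_{i-1}\to\Delta_i)$ for $i\ge1$ (a field, finite over $\mathbb{F}$); so $\mathcal{G}r(\mu)$ is an $\mathbb{F}_r$-algebra. $e_i=e(\mu_i)/e(\mu_{i-1})$, $h_i=e(\mu_i)\lambda_i$ (coprime integers), $V_i=e(\mu_{i-1})\mu_{i-1}(\phi_i)\in\mathbb{Z}$;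 $\ell_i,\ell_i'$ are the integers with $\ell_ih_i+\ell_i'e_i=1$, $0\le\ell_i<e_i$. Rational functions: $\pi_0=\pi_1=\pi$, $\Phi_0=x$, and for $1\le i\le r$, $\Phi_i=\phi_i\pi_i^{-V_i}$, $\pi_{i+1}=\Phi_i^{\ell_i}\pi_i^{\ell_i'}$. For $i\ge 1$, $\Phi_i$ is $\phi_i$ times a Laurent monomial in $\pi,\phi_1,\dots,\phi_{i-1}$, and $\pi_i$ is a Laurent monomial in $\pi,\phi_1,\dots,\phi_{i-1}$; since $H_{\mu_i}(\pi)$ and $H_{\mu_i}(\phi_k)$ ($1\le k<i$) are units in $\mathcal{G}r(\mu_i)$, one defines $x_i=H_{\mu_i}(\Phi_i)$ and $p_i=H_{\mu_i}(\pi_i)$ (a unit) in $\mathcal{G}r(\mu_i)$ by applying $H_{\mu_i}$ to each factor. For $\alpha\in\Gamma(\mu_i)$, integers $s(\alpha),u(\alpha)$ are determined by $u(\alpha)e_i+s(\alpha)h_i=e(\mu_i)\alpha$, $0\le s(\alpha)<e_i$, and $\varphi_i(\alpha)=x_i^{s(\alpha)}p_i^{u(\alpha)}\in\mathcal{G}r(\mu_i)$. *)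

(* Defs.v *)
From HB Require Import structures.
From mathcomp Require Import all_boot all_order all_algebra.
From mathcomp Require Import fraction finmap boolp monalg.

Set Implicit Arguments.
Unset Strict Implicit.
Unset Printing Implicit Defensive.

Import Order.TTheory GRing.Theory Num.Theory.
Local Open Scope ring_scope.

Notation "x %:F" := (@FracField.tofrac _ x) : ring_scope.

(* The group algebra R[G] of an additive group G: finitely supported functions
   G -> R under convolution.  [monalg] provides the additive structure; its
   product is restricted to index monoids without nontrivial units, which
   excludes groups. *)
Section GroupAlgebra.
Variables (G : zmodType) (R : comNzRingType).

Definition galg := {malg R[G]}.
HB.instance Definition _ := GRing.Zmodule.on galg.

Definition gmon (k : G) (a : R) : galg := mkmalgU k a.

Definition gmul (f g : galg) : galg :=
  \sum_(k <- msupp f) \sum_(l <- msupp g)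
    gmon (k + l) (mcoeff k f * mcoeff l g).

Lemma gmon0 k : gmon k 0 = 0. Proof. exact: monalgU0. Qed.

Lemma gmonD k a b : gmon k (a + b) = gmon k a + gmon k b.
Proof. exact: monalgUD. Qed.

Lemma galgE (f : galg) : f = \sum_(k <- msupp f) gmon k (mcoeff k f).
Proof. exact: monalgE. Qed.

Lemma gmulw (d1 d2 : {fset G}) (f g : galg) :
  (msupp f `<=` d1)%fset -> (msupp g `<=` d2)%fset ->
  gmul f g = \sum_(k <- d1) \sum_(l <- d2)
    gmon (k + l) (mcoeff k f * mcoeff l g).
Proof.
move=> le_d1 le_d2; rewrite /gmul (big_fset_incl _ le_d1) /=.
  apply/eq_bigr=> k1 _; apply/big_fset_incl => // k _ /mcoeff_outdom ->.
  by rewrite mulr0 gmon0.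
move=> k _ /mcoeff_outdom g1k.
by rewrite big1 => // k' _; rewrite g1k mul0r gmon0.
Qed.

Lemma gmulC : commutative gmul.
Proof.
move=> f g; rewrite /gmul exchange_big /=; apply: eq_bigr => k _.
by apply: eq_bigr => l _; rewrite addrC mulrC.
Qed.

Lemma gmulUU k l a b : gmul (gmon k a) (gmon l b) = gmon (k + l) (a * b).
Proof.
rewrite (gmulw (msuppU_le (k := k) (x := a)) (msuppU_le (k := l) (x := b))).
by rewrite !big_seq_fset1 !mcoeffUU.
Qed.

Lemma gmulDl : left_distributive gmul +%R.
Proof.
move=> g1 g2 g.
rewrite (gmulw (fsubsetUl (msupp g1) (msupp g2)) (fsubset_refl (msupp g))).
rewrite (gmulw (fsubsetUr (msupp g1) (msupp g2)) (fsubset_refl (msupp g))).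
rewrite (gmulw (msuppD_le g1 g2) (fsubset_refl (msupp g))).
rewrite -big_split /=; apply/eq_bigr=> k1 _.
rewrite -big_split /=; apply/eq_bigr=> k2 _.
by rewrite mcoeffD mulrDl gmonD.
Qed.

Lemma gmulDr : right_distributive gmul +%R.
Proof. by move=> f g h; rewrite gmulC gmulDl !(gmulC f). Qed.

Lemma gmul0g : left_zero 0 gmul.
Proof. by move=> g; rewrite /gmul msupp0 big_seq_fset0. Qed.

Lemma gmulg0 : right_zero 0 gmul.
Proof. by move=> g; rewrite gmulC gmul0g. Qed.

Lemma gmul_suml I (s : seq I) (F : I -> galg) g :
  gmul (\sum_(i <- s) F i) g = \sum_(i <- s) gmul (F i) g.
Proof. exact: (big_morph (gmul^~ g) (fun _ _ => gmulDl _ _ _) (gmul0g _)). Qed.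

Lemma gmul_sumr I (s : seq I) (F : I -> galg) g :
  gmul g (\sum_(i <- s) F i) = \sum_(i <- s) gmul g (F i).
Proof. exact: (big_morph (gmul g) (fun _ _ => gmulDr _ _ _) (gmulg0 _)). Qed.

Lemma gmulA : associative gmul.
Proof.
move=> f g h; rewrite (galgE f) !gmul_suml; apply: eq_bigr => i _.
rewrite (galgE g) !(gmul_suml, gmul_sumr); apply: eq_bigr => j _.
rewrite (galgE h) !(gmul_suml, gmul_sumr); apply: eq_bigr => k _.
by rewrite !gmulUU addrA mulrA.
Qed.

Lemma gmul1g : left_id (gmon 0 1) gmul.
Proof.
move=> f; rewrite {1}(galgE f) gmul_sumr [RHS]galgE; apply: eq_bigr => i _.
by rewrite gmulUU add0r mul1r.
Qed.

Lemma gone_neq0 : gmon 0 1 != 0.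
Proof. by rewrite monalgU_eq0 oner_eq0. Qed.

HB.instance Definition _ :=
  GRing.Zmodule_isComNzRing.Build galg gmulA gmulC gmul1g gmulDl gone_neq0.

Lemma gmonM k l a b : gmon k a * gmon l b = gmon (k + l) (a * b).
Proof. exact: gmulUU. Qed.

Lemma mcoeff_gB (f g : galg) k : mcoeff k (f - g) = mcoeff k f - mcoeff k g.
Proof. exact: mcoeffB. Qed.

Lemma mcoeff_gD (f g : galg) k : mcoeff k (f + g) = mcoeff k f + mcoeff k g.
Proof. exact: mcoeffD. Qed.

Lemma mcoeff_gmul (f g : galg) m :
  mcoeff m (f * g) = \sum_(k <- msupp f) \sum_(l <- msupp g)
    (mcoeff k f * mcoeff l g) *+ (k + l == m).
Proof.
have -> : f * g = gmul f g by [].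
rewrite /gmul raddf_sum; apply: eq_bigr => k _.
by rewrite raddf_sum; apply: eq_bigr => l _; exact: mcoeffU.
Qed.

End GroupAlgebra.

(* For a valuation the value at 0 is conventionally infinite: the functions
   below are only constrained, and only ever evaluated, at nonzero arguments. *)
Record discrete_valuation (K : fieldType) := DiscreteValuation {
  dval :> K -> int;
  dvalM : forall a b, a != 0 -> b != 0 -> dval (a * b) = dval a + dval b;
  dvalD : forall a b, a != 0 -> b != 0 -> a + b != 0 ->
    Num.min (dval a) (dval b) <= dval (a + b);
  dval_surj : forall n : int, exists2 a, a != 0 & dval a = n
}.

Section BaseField.
Variables (K : fieldType) (v : discrete_valuation K).

Definition in_O (a : K) : bool := (a == 0) || (0 <= v a).
Definition in_m (a : K) : bool := (a == 0) || (0 < v a).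

Definition uniformizer (pi : K) : Prop :=
  forall a, in_m a <-> exists2 b, in_O b & a = pi * b.

(* The set V; [vram mu] is e(mu), uniquely determined by e(mu) Gamma(mu) = Z. *)
Record extension_valuation := ExtensionValuation {
  vval :> {fraction {poly K}} -> rat;
  vvalM : forall f g, f != 0 -> g != 0 -> vval (f * g) = vval f + vval g;
  vvalD : forall f g, f != 0 -> g != 0 -> f + g != 0 ->
    Num.min (vval f) (vval g) <= vval (f + g);
  vval_base : forall a : K, a != 0 -> vval (a%:P)%:F = (v a)%:~R;
  vval_X : 0 <= vval ('X)%:F;
  vram : nat;
  vram_gt0 : (0 < vram)%N;
  vram_int : forall f, f != 0 -> exists z : int, vram%:R * vval f = z%:~R;
  vram_surj : forall z : int, exists2 f, f != 0 & vram%:R * vval f = z%:~R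
}.

Implicit Types (mu : extension_valuation) (al be : rat) (g h : {poly K}).

Definition value_group mu al : Prop := exists2 f, f != 0 & mu f = al.

Definition val_le mu mu' : Prop :=
  forall g, g != 0 -> mu g%:F <= mu' g%:F.

Definition pol_ge mu al : {pred {poly K}} :=
  [pred g | (g == 0) || (al <= mu g%:F)].
Definition pol_gt mu al : {pred {poly K}} :=
  [pred g | (g == 0) || (al < mu g%:F)].

Lemma vval1 mu : mu 1 = 0.
Proof.
have := @vvalM mu 1 1 (oner_neq0 _) (oner_neq0 _).
by rewrite mul1r -{1}[mu 1]addr0 => /addrI.
Qed.

Lemma vvalN mu f : f != 0 -> mu (- f) = mu f.
Proof.
move=> f0; have N10 : (-1 : {fraction {poly K}}) != 0 by rewrite oppr_eq0 oner_neq0.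
have : mu (-1) *+ 2 = 0 by rewrite mulr2n -vvalM // mulrNN mulr1 vval1.
move/eqP; rewrite mulrn_eq0 /= => /eqP h1.
by rewrite -mulN1r vvalM // h1 add0r.
Qed.

Lemma pol_geN mu al g : g \in pol_ge mu al -> - g \in pol_ge mu al.
Proof.
rewrite !inE oppr_eq0; have [//|g0 /=] := eqVneq g 0.
by rewrite tofracN vvalN // tofrac_eq0.
Qed.

Lemma pol_gtN mu al g : g \in pol_gt mu al -> - g \in pol_gt mu al.
Proof.
rewrite !inE oppr_eq0; have [//|g0 /=] := eqVneq g 0.
by rewrite tofracN vvalN // tofrac_eq0.
Qed.

Lemma pol_geD mu al g h :
  g \in pol_ge mu al -> h \in pol_ge mu al -> g + h \in pol_ge mu al.
Proof.
rewrite !inE.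
have [->|g0 /= ga] := eqVneq g 0; first by rewrite add0r.
have [->|h0 /= ha] := eqVneq h 0; first by rewrite addr0 ga orbT.
have [//|s0 /=] := eqVneq (g + h) 0.
rewrite tofracD; apply: le_trans (vvalD _ _ _ _); rewrite ?tofrac_eq0 //.
  by rewrite le_min ga ha.
by rewrite -tofracD tofrac_eq0.
Qed.

Lemma pol_gtD mu al g h :
  g \in pol_gt mu al -> h \in pol_gt mu al -> g + h \in pol_gt mu al.
Proof.
rewrite !inE.
have [->|g0 /= ga] := eqVneq g 0; first by rewrite add0r.
have [->|h0 /= ha] := eqVneq h 0; first by rewrite addr0 ga orbT.
have [//|s0 /=] := eqVneq (g + h) 0.
rewrite tofracD; apply: lt_le_trans (vvalD _ _ _ _); rewrite ?tofrac_eq0 //.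
  by rewrite lt_min ga ha.
by rewrite -tofracD tofrac_eq0.
Qed.

Lemma pol_geM mu al be g h :
  g \in pol_ge mu al -> h \in pol_ge mu be -> g * h \in pol_ge mu (al + be).
Proof.
rewrite !inE.
have [->|g0 /= ga] := eqVneq g 0; first by rewrite mul0r eqxx.
have [->|h0 /= ha] := eqVneq h 0; first by rewrite mulr0 eqxx.
by rewrite tofracM vvalM ?tofrac_eq0 // lerD ?orbT.
Qed.

Lemma pol_gtM mu al be g h :
  g \in pol_ge mu al -> h \in pol_gt mu be -> g * h \in pol_gt mu (al + be).
Proof.
rewrite !inE.
have [->|g0 /= ga] := eqVneq g 0; first by rewrite mul0r eqxx.
have [->|h0 /= ha] := eqVneq h 0; first by rewrite mulr0 eqxx.
by rewrite tofracM vvalM ?tofrac_eq0 // ler_ltD ?orbT.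
Qed.

Lemma pol_ge0 mu al : 0 \in pol_ge mu al. Proof. by rewrite inE eqxx. Qed.
Lemma pol_gt0 mu al : 0 \in pol_gt mu al. Proof. by rewrite inE eqxx. Qed.

Lemma pol_ge_sum mu al I (s : seq I) (F : I -> {poly K}) :
  (forall i, F i \in pol_ge mu al) -> \sum_(i <- s) F i \in pol_ge mu al.
Proof.
move=> hF; elim/big_ind: _ => [|x y|i _]; [exact: pol_ge0|exact: pol_geD|exact: hF].
Qed.

Lemma pol_gt_sum mu al I (s : seq I) (F : I -> {poly K}) :
  (forall i, F i \in pol_gt mu al) -> \sum_(i <- s) F i \in pol_gt mu al.
Proof.
move=> hF; elim/big_ind: _ => [|x y|i _]; [exact: pol_gt0|exact: pol_gtD|exact: hF].
Qed.

End BaseField.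

(* Gr(mu) is realized as (\bigoplus_al P_al) / (\bigoplus_al P_al^+): the direct
   sums are subsets of the group algebra K[x][Q], the first a subring and the
   second an ideal of it.  All rational degrees are allowed; this changes
   nothing, since P_al = P_al^+ when al is not in Gamma(mu). *)
Section Graded.
Variables (K : fieldType) (v : discrete_valuation K).
Variable mu : extension_valuation v.

Definition rees_pred : {pred galg rat {poly K}} :=
  [pred f : galg rat {poly K} |
    all (fun al => mcoeff al f \in pol_ge mu al) (msupp f)].

Lemma reesP (f : galg rat {poly K}) :
  reflect (forall al, mcoeff al f \in pol_ge mu al) (f \in rees_pred).
Proof.
apply: (iffP allP) => h al; last by move=> _; exact: h.
by have [/h//|/mcoeff_outdom ->] := boolP (al \in msupp f); exact: pol_ge0.
Qed.

Fact rees_subring : subring_closed rees_pred.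
Proof.
split=> [|f g /reesP hf /reesP hg|f g /reesP hf /reesP hg].
- apply/reesP => al; rewrite mcoeffU; case: eqP => [<-|_].
    by rewrite mulr1n inE oner_eq0 /= tofrac1 vval1.
  by rewrite mulr0n pol_ge0.
- by apply/reesP => al; rewrite mcoeff_gB pol_geD ?pol_geN.
- apply/reesP => al; rewrite mcoeff_gmul.
  apply: pol_ge_sum => k; apply: pol_ge_sum => l.
  case: eqP => [<-|_]; last by rewrite mulr0n pol_ge0.
  by rewrite mulr1n pol_geM.
Qed.

HB.instance Definition _ :=
  GRing.isSubringClosed.Build _ rees_pred rees_subring.

Record rees := Rees { rees_val :> galg rat {poly K}; _ : rees_val \in rees_pred }.
HB.instance Definition _ := [isSub for rees_val].
HB.instance Definition _ := [Choice of rees by <:].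
HB.instance Definition _ := [SubChoice_isSubComNzRing of rees by <:].

Definition rees_plus : {pred rees} :=
  [pred f : rees |
    all (fun al => mcoeff al (val f) \in pol_gt mu al) (msupp (val f))].

Arguments rees_plus : clear implicits.

Lemma rees_plusP (f : rees) :
  reflect (forall al, mcoeff al (val f) \in pol_gt mu al) (f \in rees_plus).
Proof.
apply: (iffP allP) => h al; last by move=> _; exact: h.
by have [/h//|/mcoeff_outdom ->] := boolP (al \in msupp (val f)); exact: pol_gt0.
Qed.

Fact rees_plus_ideal : idealr_closed rees_plus.
Proof.
split=> [||a f g /rees_plusP hf /rees_plusP hg].
- by apply/rees_plusP => al; rewrite [mcoeff _ _]mcoeff0 pol_gt0.
- apply/negP => /rees_plusP /(_ 0).
  by rewrite rmorph1 mcoeffUU inE oner_eq0 tofrac1 vval1 ltxx.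
- apply/rees_plusP => al.
  have -> : val (a * f + g) = val a * val f + val g by [].
  rewrite mcoeff_gD; apply: pol_gtD => //; rewrite mcoeff_gmul.
  apply: pol_gt_sum => k; apply: pol_gt_sum => l.
  case: eqP => [<-|_]; last by rewrite mulr0n pol_gt0.
  by rewrite mulr1n pol_gtM //; apply/reesP/valP.
Qed.

HB.instance Definition _ := isIdealr.Build _ rees_plus rees_plus_ideal.

Definition Gr := {ideal_quot rees_plus}.
HB.instance Definition _ := GRing.ComNzRing.on Gr.

Definition Gr_unit : {pred Gr} := [pred x | `[< exists y, y * x = 1 >]].
Definition Gr_inv (x : Gr) : Gr :=
  if pselect (exists y, y * x = 1) is left h then projT1 (cid h) else x.

Fact Gr_mulVx : {in Gr_unit, left_inverse 1 Gr_inv *%R}.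
Proof.
move=> x /asboolP h; rewrite /Gr_inv; case: pselect => // h'.
exact: (projT2 (cid h')).
Qed.
Fact Gr_unitPl x y : y * x = 1 -> Gr_unit x.
Proof. by move=> h; apply/asboolP; exists y. Qed.
Fact Gr_inv_out : {in [predC Gr_unit], Gr_inv =1 id}.
Proof.
by move=> x /negP h; rewrite /Gr_inv; case: pselect => // h'; case: h; apply/asboolP.
Qed.

HB.instance Definition _ :=
  GRing.ComNzRing_hasMulInverse.Build Gr Gr_mulVx Gr_unitPl Gr_inv_out.

End Graded.

Arguments rees_plus {K v} mu _.

Section GradedTheory.
Variables (K : fieldType) (v : discrete_valuation K).
Implicit Types (mu : extension_valuation v) (al be : rat) (g h : {poly K}).

(* The image of g in P_al / P_al^+, for g in P_al. *)
Definition gr_class mu al g : Gr mu :=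
  \pi_(Gr mu)%qT (insubd (0 : rees mu) (gmon al g)).

Definition Gr_component mu al (u : Gr mu) : Prop :=
  exists2 g, g \in pol_ge mu al & u = gr_class mu al g.

Definition Delta mu : Gr mu -> Prop := Gr_component (mu := mu) 0.

Definition initial_form mu g : Gr mu :=
  if g == 0 then 0 else gr_class mu (mu g%:F) g.

Definition gr_equiv mu g h : Prop := initial_form mu g = initial_form mu h.

Definition gr_dvd mu h g : Prop :=
  exists u : Gr mu, initial_form mu g = initial_form mu h * u.

(* Induced by the inclusions P_al(mu) <= P_al(mu'); only meaningful when
   mu <= mu', see [gr_map_class] and [gr_map_initial_form]. *)
Definition gr_map mu mu' (u : Gr mu) : Gr mu' :=
  \pi_(Gr mu')%qT (insubd (0 : rees mu') (val (repr u))).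

Lemma gmon_rees mu al g : (gmon al g \in rees_pred mu) = (g \in pol_ge mu al).
Proof.
apply/reesP/idP => [/(_ al)|h be]; first by rewrite mcoeffUU.
by rewrite mcoeffU; case: eqP => [<-|_]; rewrite ?mulr1n ?mulr0n ?pol_ge0.
Qed.

Lemma gr_eqP mu (f g : rees mu) :
  reflect (\pi_(Gr mu)%qT f = \pi_(Gr mu)%qT g) (f - g \in rees_plus mu).
Proof. by rewrite Quotient.idealrBE; exact: eqP. Qed.

Lemma gr_class_rees mu al g (gP : g \in pol_ge mu al)
    (gR : gmon al g \in rees_pred mu) :
  gr_class mu al g = \pi_(Gr mu)%qT (Rees gR).
Proof. by rewrite /gr_class; congr (\pi_(_)%qT _); apply: val_inj; rewrite val_insubd gR. Qed.

Lemma gr_classB mu al g h : g \in pol_ge mu al -> h \in pol_ge mu al ->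
  gr_class mu al (g - h) = gr_class mu al g - gr_class mu al h.
Proof.
move=> gP hP; have ghP : g - h \in pol_ge mu al by rewrite pol_geD ?pol_geN.
have [gR hR ghR] : [/\ gmon al g \in rees_pred mu, gmon al h \in rees_pred mu
  & gmon al (g - h) \in rees_pred mu] by rewrite !gmon_rees.
rewrite (gr_class_rees gP gR) (gr_class_rees hP hR) (gr_class_rees ghP ghR).
rewrite -[RHS]rmorphB; congr (\pi_(_)%qT _); apply: val_inj.
exact: monalgUB.
Qed.

Lemma gr_classM mu al be g h : g \in pol_ge mu al -> h \in pol_ge mu be ->
  gr_class mu (al + be) (g * h) = gr_class mu al g * gr_class mu be h.
Proof.
move=> gP hP; have ghP : g * h \in pol_ge mu (al + be) by rewrite pol_geM.
have [gR hR ghR] : [/\ gmon al g \in rees_pred mu, gmon be h \in rees_pred mu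
  & gmon (al + be) (g * h) \in rees_pred mu] by rewrite !gmon_rees.
rewrite (gr_class_rees gP gR) (gr_class_rees hP hR) (gr_class_rees ghP ghR).
rewrite -[RHS]rmorphM; congr (\pi_(_)%qT _); apply: val_inj.
by rewrite /= -gmonM.
Qed.

Lemma pol_ge1 mu : 1 \in pol_ge mu 0.
Proof. by rewrite inE oner_eq0 tofrac1 vval1 lexx. Qed.

Lemma gr_class1 mu : gr_class mu 0 1 = 1.
Proof.
have oR : gmon 0 1 \in rees_pred mu by rewrite gmon_rees pol_ge1.
rewrite (gr_class_rees (pol_ge1 mu) oR) -[RHS](rmorph1 \pi_(Gr mu)%qT).
by congr (\pi_(_)%qT _); apply: val_inj.
Qed.

Lemma gr_class_eq mu al g h : g \in pol_ge mu al -> h \in pol_ge mu al ->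
  (gr_class mu al g = gr_class mu al h <-> g - h \in pol_gt mu al).
Proof.
move=> gP hP.
have [gR hR] : gmon al g \in rees_pred mu /\ gmon al h \in rees_pred mu.
  by rewrite !gmon_rees.
have E : val (Rees gR - Rees hR) = gmon al (g - h).
  by have -> : val (Rees gR - Rees hR) = gmon al g - gmon al h by []; rewrite [RHS]monalgUB.
rewrite (gr_class_rees gP gR) (gr_class_rees hP hR).
split => [/gr_eqP /rees_plusP /(_ al)|ghP]; first by rewrite E mcoeffUU.
apply/gr_eqP/rees_plusP => be; rewrite E mcoeffU.
by case: eqP => [<-|_]; rewrite ?mulr1n ?mulr0n ?pol_gt0.
Qed.

Lemma pol_ge_val mu g : g \in pol_ge mu (mu g%:F).
Proof. by rewrite inE lexx orbT. Qed.

Lemma initial_formM mu g h :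
  initial_form mu (g * h) = initial_form mu g * initial_form mu h.
Proof.
rewrite /initial_form mulf_eq0.
have [_|g0] /= := eqVneq g 0; first by rewrite mul0r.
have [_|h0] /= := eqVneq h 0; first by rewrite mulr0.
by rewrite tofracM vvalM ?tofrac_eq0 // gr_classM ?pol_ge_val.
Qed.

Lemma val_le_pol_ge mu mu' al g :
  val_le mu mu' -> g \in pol_ge mu al -> g \in pol_ge mu' al.
Proof.
move=> le_mu; rewrite !inE; have [//|g0 /= ga] := eqVneq g 0.
exact: le_trans ga (le_mu _ g0).
Qed.

Lemma val_le_pol_gt mu mu' al g :
  val_le mu mu' -> g \in pol_gt mu al -> g \in pol_gt mu' al.
Proof.
move=> le_mu; rewrite !inE; have [//|g0 /= ga] := eqVneq g 0.
exact: lt_le_trans ga (le_mu _ g0).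
Qed.

Section GrMap.
Variables (mu mu' : extension_valuation v) (le_mu : val_le mu mu').

Lemma val_le_rees (f : rees mu) : val f \in rees_pred mu'.
Proof. by apply/reesP => al; apply: (val_le_pol_ge le_mu); apply/reesP/valP. Qed.

Lemma gr_map_pi (f : rees mu) :
  gr_map mu' (\pi_(Gr mu)%qT f) = \pi_(Gr mu')%qT (Rees (val_le_rees f)).
Proof.
rewrite /gr_map; apply/gr_eqP/rees_plusP => al.
set f' := repr _; have /gr_eqP /rees_plusP /(_ al) hf : \pi_(Gr mu)%qT f' = \pi_(Gr mu)%qT f.
  by rewrite reprK.
apply: (val_le_pol_gt le_mu).
suff <- : val (f' - f) = val (insubd (0 : rees mu') (val f') - Rees (val_le_rees f)) by [].
have -> : val (insubd (0 : rees mu') (val f') - Rees (val_le_rees f))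
  = val (insubd (0 : rees mu') (val f')) - val f by [].
by rewrite val_insubd val_le_rees.
Qed.

Lemma gr_mapB : {morph gr_map mu' : x y / x - y : Gr mu >-> x - y}.
Proof.
elim/quotW => f; elim/quotW => g.
rewrite !gr_map_pi -[X in gr_map _ X]rmorphB gr_map_pi -[RHS]rmorphB.
by congr (\pi_(_)%qT _); apply: val_inj.
Qed.

Lemma gr_mapM : {morph gr_map mu' : x y / x * y : Gr mu >-> x * y}.
Proof.
elim/quotW => f; elim/quotW => g.
rewrite !gr_map_pi -[X in gr_map _ X]rmorphM gr_map_pi -[RHS]rmorphM.
by congr (\pi_(_)%qT _); apply: val_inj.
Qed.

Lemma gr_map1 : gr_map mu' (1 : Gr mu) = 1.
Proof.
rewrite -(rmorph1 \pi_(Gr mu)%qT) gr_map_pi -(rmorph1 \pi_(Gr mu')%qT).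
by congr (\pi_(_)%qT _); apply: val_inj.
Qed.

Lemma gr_map_class al g : g \in pol_ge mu al ->
  gr_map mu' (gr_class mu al g) = gr_class mu' al g.
Proof.
move=> gP; have gP' := val_le_pol_ge le_mu gP.
have [gR gR'] : gmon al g \in rees_pred mu /\ gmon al g \in rees_pred mu'.
  by rewrite !gmon_rees.
rewrite (gr_class_rees gP gR) (gr_class_rees gP' gR') gr_map_pi.
by congr (\pi_(_)%qT _); apply: val_inj.
Qed.

Lemma gr_map_initial_form g :
  gr_map mu' (initial_form mu g) =
  if (g != 0) && (mu g%:F == mu' g%:F) then initial_form mu' g else 0.
Proof.
rewrite /initial_form; have [->|g0] /= := eqVneq g 0.
  by have := gr_mapB 0 0; rewrite !subrr.
rewrite gr_map_class ?pol_ge_val //; case: eqP => [->//|/eqP ne].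
have P0 : 0 \in pol_ge mu' (mu g%:F) by rewrite pol_ge0.
have <- : gr_class mu' (mu g%:F) 0 = 0 by have := gr_classB P0 P0; rewrite !subrr.
apply/gr_class_eq => //.
  by apply: (val_le_pol_ge le_mu); rewrite pol_ge_val.
by rewrite subr0 inE lt_neqAle ne le_mu ?orbT.
Qed.

End GrMap.

Definition principal_ideal mu (u : Gr mu) : {pred Gr mu} :=
  [pred w | `[< exists z, w = u * z >]].

Definition key_polynomial mu (phi : {poly K}) : Prop :=
  [/\ phi \is monic, (1 < size phi)%N,
      [/\ initial_form mu phi != 0,
          idealr_closed (principal_ideal (initial_form mu phi))
        & prime_idealr_closed (principal_ideal (initial_form mu phi))]
    & forall g, g != 0 -> (size g < size phi)%N -> ~ gr_dvd mu phi g].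

(* m = min { f s | P s } *)
Definition is_min (P : nat -> Prop) (f : nat -> rat) (m : rat) : Prop :=
  (exists2 s, P s & m = f s) /\ (forall s, P s -> m <= f s).

(* mu = mu_0 *)
Definition gauss_valuation mu : Prop :=
  forall g, g != 0 ->
    is_min (fun s => g`_s != 0) (fun s => (v g`_s)%:~R) (mu g%:F).

(* mu' = [mu; (phi, lam)]; the minimum ranges over the nonzero terms of the
   phi-expansion c of g. *)
Definition augmentation mu (phi : {poly K}) (lam : rat) mu' : Prop :=
  forall (c : seq {poly K}) g,
    all (fun a : {poly K} => size a < size phi)%N c ->
    g = \sum_(s < size c) c`_s * phi ^+ s -> g != 0 ->
    is_min (fun s => c`_s != 0)
      (fun s => mu (c`_s * phi ^+ s)%:F + s%:R * lam) (mu' g%:F).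

Lemma phi_expansion (phi g : {poly K}) : phi \is monic -> (1 < size phi)%N ->
  exists2 c : seq {poly K}, all (fun a : {poly K} => size a < size phi)%N c
    & g = \sum_(s < size c) c`_s * phi ^+ s.
Proof.
move=> phiM phi1; have phi0 := monic_neq0 phiM.
have [n] := ubnP (size g); elim: n g => // n IHn g; rewrite ltnS => gn.
have [->|g0] := eqVneq g 0; first by exists [::]; rewrite // big_ord0.
have q_lt : (size (g %/ phi)%R < n)%N.
  rewrite size_divp //; apply: leq_trans gn.
  by rewrite ltn_subrL size_poly_gt0 g0 andbT; case: (size phi) phi1 => [|[]].
have [c cP qE] := IHn _ q_lt.
exists ((g %% phi) :: c); first by rewrite /= ltn_modp phi0.
rewrite /= big_ord_recl /= expr0 mulr1 {1}(divp_eq g phi) addrC; congr (_ + _).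
rewrite {1}qE mulr_suml; apply: eq_bigr => i _.
by rewrite -mulrA -exprSr.
Qed.

Lemma key_expansion_ge mu phi : key_polynomial mu phi ->
  forall (c : seq {poly K}) al,
  all (fun a : {poly K} => size a < size phi)%N c ->
  \sum_(s < size c) c`_s * phi ^+ s \in pol_ge mu al ->
  forall s, c`_s * phi ^+ s \in pol_ge mu al.
Proof.
move=> [phiM phi1 _ phi_min]; have phi0 := monic_neq0 phiM.
elim=> [|a c IHc] al /=; first by move=> _ _ s; rewrite nth_nil mul0r pol_ge0.
case/andP=> a_lt c_lt; rewrite big_ord_recl /= expr0 mulr1.
under eq_bigr do rewrite /bump /= add1n exprSr mulrA.
rewrite -mulr_suml; set q := \sum_(s < _) _ => gP.
have aP : a \in pol_ge mu al.
  have [->|a0] := eqVneq a 0; first exact: pol_ge0.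
  apply/negPn/negP => aNP; apply: (phi_min a a0 a_lt).
  have a_al : mu a%:F < al by move: aNP; rewrite inE (negPf a0) /= -ltNge.
  pose g := a + q * phi.
  have gP' : g \in pol_gt mu (mu a%:F).
    by move: gP; rewrite !inE => /orP[->//|/(lt_le_trans a_al) ->]; rewrite orbT.
  have gP'' : g \in pol_ge mu (mu a%:F).
    by move: gP'; rewrite !inE => /orP[->//|/ltW ->]; rewrite orbT.
  have qE : - q * phi = a - g by rewrite /g opprD addrA subrr add0r mulNr.
  have qP : - q * phi \in pol_ge mu (mu a%:F).
    by rewrite qE pol_geD ?pol_ge_val ?pol_geN.
  have ne_q : - q * phi != 0.
    apply/eqP => q0; move: gP'; have <- : a = g by apply/eqP; rewrite -subr_eq0 -qE q0.
    by rewrite inE (negPf a0) ltxx.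
  have cl : gr_class mu (mu a%:F) a = gr_class mu (mu a%:F) (- q * phi).
    by apply/gr_class_eq; rewrite ?pol_ge_val // qE opprB addrC subrK.
  have vE : mu (- q * phi)%:F = mu a%:F.
    apply/eqP; rewrite eq_le; apply/andP; split; last by move: qP; rewrite inE (negPf ne_q).
    rewrite leNgt; apply/negP => lt_a.
    have : a \in pol_gt mu (mu a%:F).
      have {1}-> : a = - q * phi + g by rewrite qE subrK.
      by rewrite pol_gtD // inE lt_a orbT.
    by rewrite inE (negPf a0) ltxx.
  exists (initial_form mu (- q)); rewrite -initial_formM (mulrC phi) /initial_form.
  by rewrite (negPf a0) (negPf ne_q) vE.
have qphiP : q * phi \in pol_ge mu al.
  have -> : q * phi = a + q * phi - a by rewrite addrC addKr.
  by rewrite pol_geD ?pol_geN.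
have phi_val x be : x * phi \in pol_ge mu be <-> x \in pol_ge mu (be - mu phi%:F).
  rewrite !inE mulf_eq0 (negPf phi0) orbF; have [//|x0 /=] := eqVneq x 0.
  by rewrite tofracM vvalM ?tofrac_eq0 // lerBlDr.
case=> [|s] /=; first by rewrite expr0 mulr1.
by rewrite exprSr mulrA; apply/phi_val/IHc => //; apply/phi_val.
Qed.

Lemma augmentation_le mu mu' phi (lam : rat) :
  key_polynomial mu phi -> 0 < lam -> augmentation mu phi lam mu' ->
  val_le mu mu'.
Proof.
move=> key lam0 aug g g0; have [phiM phi1 _ _] := key.
have [c cP gE] := phi_expansion g phiM phi1.
have [[s cs ->] _] := aug c g cP gE g0.
have := key_expansion_ge key cP (al := mu g%:F).
rewrite -gE pol_ge_val => /(_ isT s).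
rewrite inE mulf_eq0 (negPf cs) expf_eq0 (negPf (monic_neq0 phiM)) andbF /=.
by move=> h; apply: ler_wpDr => //; rewrite mulr_ge0 ?ler0n // ltW.
Qed.

End GradedTheory.

Record maclane_chain (K : fieldType) (v : discrete_valuation K) (r : nat) :=
MacLaneChain {
  mac_mu : nat -> extension_valuation v;
  mac_phi : nat -> {poly K};
  mac_lam : nat -> rat;
  mac_phi0 : mac_phi 0%N = 'X;
  mac_lam0 : mac_lam 0%N = 0;
  mac_mu0 : gauss_valuation (mac_mu 0%N);
  mac_key : forall i, (i < r)%N -> key_polynomial (mac_mu i) (mac_phi i.+1);
  mac_lam_gt0 : forall i, (i < r)%N -> 0 < mac_lam i.+1;
  mac_step : forall i, (i < r)%N ->
    augmentation (mac_mu i) (mac_phi i.+1) (mac_lam i.+1) (mac_mu i.+1);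
  mac_nequiv : forall i, (0 < i < r)%N ->
    ~ gr_equiv (mac_mu i) (mac_phi i.+1) (mac_phi i)
}.

(* For coprime h and e with e > 0, the pair (s, u) such that
   s * h + u * e = n and 0 <= s < e. *)
Definition bezout_pair (h e n : int) : int * int :=
  let s := ((n * (egcdz h e).1) %% e)%Z in (s, ((n - s * h) %/ e)%Z).

Lemma bezout_pairP (h e n : int) : coprimez h e -> 0 < e ->
  let: (s, u) := bezout_pair h e n in
  [/\ s * h + u * e = n, 0 <= s & s < e].
Proof.
move=> co e0; rewrite /bezout_pair; set s := (_ %% e)%Z.
have e_neq0 : e != 0 by rewrite gt_eqF.
split; [|exact: modz_ge0|exact: ltz_pmod].
suff /dvdzP [q E] : (e %| n - s * h)%Z by rewrite E mulzK // -E addrC subrK.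
case: egcdzP @s => a b E _; rewrite (eqP co) in E.
rewrite /= -[X in (_ %| X - _)%Z]mulr1 -E.
have -> : (n * a %% e)%Z = n * a - (n * a %/ e)%Z * e.
  by apply/eqP; rewrite eq_sym subr_eq addrC -divz_eq.
apply/dvdzP; exists (n * b + (n * a %/ e)%Z * h).
rewrite mulrBl mulrDr mulrDl !mulrA opprB addrC addrA subrK addrC.
by congr (_ + _); rewrite mulrAC.
Qed.

Section MacLaneData.
Variables (K : fieldType) (v : discrete_valuation K) (pi : K).
Variables (r : nat) (c : maclane_chain v r).

Local Notation mu := (mac_mu c).
Local Notation phi := (mac_phi c).
Local Notation lam := (mac_lam c).

(* mu_{i-1}, with mu_{-1} = mu_0 *)
Definition mac_prev (i : nat) := mu i.-1.

(* For 0 <= i <= r (1 <= i <= r for V) the division and the numerators below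
   are those of exact quotients and of rationals that are integers. *)
Definition mac_e (i : nat) : nat := vram (mu i) %/ vram (mac_prev i).
Definition mac_h (i : nat) : int := numq ((vram (mu i))%:R * lam i).
Definition mac_V (i : nat) : int :=
  numq ((vram (mac_prev i))%:R * mac_prev i (phi i)%:F).
Definition mac_l (i : nat) : int := (bezout_pair (mac_h i) (mac_e i) 1).1.
Definition mac_l' (i : nat) : int := (bezout_pair (mac_h i) (mac_e i) 1).2.

(* The recursion of the pairs (pi_i, Phi_i), started from arbitrary values a of
   pi and f k of phi_k.  In K(x), with the actual pi and phi_k, it yields the
   rational functions pi_i and Phi_i; with initial forms in Gr(mu_i) it applies
   H_{mu_i} to each factor of these Laurent monomials. *)
Fixpoint mac_monomials (R : comUnitRingType) (a : R) (f : nat -> R) (i : nat) :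
    R * R :=
  if i is j.+1 then
    let: (p, F) := mac_monomials a f j in
    let p' := if j is 0 then a else F ^ mac_l j * p ^ mac_l' j in
    (p', f i * p' ^ (- mac_V i))
  else (a, f 0%N).

Definition mac_p (i : nat) : Gr (mu i) :=
  (mac_monomials (initial_form (mu i) pi%:P)
     (fun k => initial_form (mu i) (phi k)) i).1.
Definition mac_x (i : nat) : Gr (mu i) :=
  (mac_monomials (initial_form (mu i) pi%:P)
     (fun k => initial_form (mu i) (phi k)) i).2.

Definition mac_varphi (i : nat) (al : rat) : Gr (mu i) :=
  let: (s, u) :=
    bezout_pair (mac_h i) (mac_e i) (numq ((vram (mu i))%:R * al)) in
  mac_x i ^ s * mac_p i ^ u.

Definition varphi_Delta (i : nat) (al : rat) (u : Gr (mu i)) : Prop :=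
  exists2 d, Delta d & u = mac_varphi i al * d.

(* The subring F_i of Gr(mu_i).  For i = 0 the image of the residue field is
   that of the valuation ring, which surjects onto it. *)
Definition mac_F (i : nat) : {pred Gr (mu i)} :=
  match i with
  | 0 => [pred u | `[< exists2 a, in_O v a & u = gr_class (mu 0%N) 0 a%:P >]]
  | j.+1 => [pred u | `[< exists2 w, Delta w & u = gr_map (mu j.+1) (w : Gr (mu j)) >]]
  end.

Arguments mac_F : clear implicits.

Lemma mac_le (i : nat) : (i < r)%N -> val_le (mu i) (mu i.+1).
Proof.
move=> ir; exact: (augmentation_le (@mac_key _ _ _ c i ir) (mac_lam_gt0 c ir)
                     (@mac_step _ _ _ c i ir)).
Qed.

Lemma pol_ge_const (nu : extension_valuation v) (a : K) :
  in_O v a -> a%:P \in pol_ge nu 0.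
Proof.
rewrite /in_O inE polyC_eq0; have [//|a0 /=] := eqVneq a 0.
by rewrite vval_base // ler0z.
Qed.

Lemma in_OB a b : in_O v a -> in_O v b -> in_O v (a - b).
Proof.
move=> aO bO; rewrite /in_O.
have := pol_geD (pol_ge_const (mu 0%N) aO) (pol_geN (pol_ge_const (mu 0%N) bO)).
rewrite -polyCN -polyCD inE polyC_eq0; have [//|ab0 /=] := eqVneq (a - b) 0.
by rewrite vval_base // ler0z.
Qed.

Lemma in_OM a b : in_O v a -> in_O v b -> in_O v (a * b).
Proof.
move=> aO bO; rewrite /in_O.
have := pol_geM (pol_ge_const (mu 0%N) aO) (pol_ge_const (mu 0%N) bO).
rewrite -polyCM addr0 inE polyC_eq0; have [//|ab0 /=] := eqVneq (a * b) 0.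
by rewrite vval_base // ler0z.
Qed.

Lemma in_O1 : in_O v 1.
Proof.
rewrite /in_O oner_eq0 /=; have := vval_base (mu 0%N) (oner_neq0 K).
by rewrite tofrac1 vval1 => /esym/eqP; rewrite intr_eq0 => /eqP ->.
Qed.

Fact mac_F_subring (i : nat) : (i <= r)%N -> subring_closed (mac_F i).
Proof.
case: i => [_|j jr]; split.
- by apply/asboolP; exists 1; rewrite ?in_O1 // gr_class1.
- move=> _ _ /asboolP [a aO ->] /asboolP [b bO ->]; apply/asboolP.
  exists (a - b); first exact: in_OB.
  by rewrite polyCB gr_classB // pol_ge_const.
- move=> _ _ /asboolP [a aO ->] /asboolP [b bO ->]; apply/asboolP.
  exists (a * b); first exact: in_OM.
  by rewrite polyCM -[0 in RHS]addr0 gr_classM // pol_ge_const.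
- apply/asboolP; exists 1; last by rewrite gr_map1 //; exact: mac_le.
  by exists 1; rewrite ?pol_ge1 // gr_class1.
- move=> _ _ /asboolP [_ [g gP ->] ->] /asboolP [_ [h hP ->] ->]; apply/asboolP.
  exists (gr_class (mu j) 0 g - gr_class (mu j) 0 h).
    by exists (g - h); rewrite ?gr_classB // pol_geD ?pol_geN.
  by rewrite gr_mapB //; exact: mac_le.
- move=> _ _ /asboolP [_ [g gP ->] ->] /asboolP [_ [h hP ->] ->]; apply/asboolP.
  exists (gr_class (mu j) 0 g * gr_class (mu j) 0 h).
    exists (g * h); first by rewrite -[0]addr0 pol_geM.
    by rewrite -[0 in RHS]addr0 gr_classM.
  by rewrite gr_mapM //; exact: mac_le.
Qed.

Definition Fr_pred : {pred Gr (mu r)} := mac_F r.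
HB.instance Definition _ :=
  GRing.isSubringClosed.Build _ Fr_pred (mac_F_subring (leqnn r)).

Record Fr := FrElement { Fr_val :> Gr (mu r); _ : Fr_val \in Fr_pred }.
HB.instance Definition _ := [isSub for Fr_val].
HB.instance Definition _ := [Choice of Fr by <:].
HB.instance Definition _ := [SubChoice_isSubComNzRing of Fr by <:].

(* F_r[y][p, p^-1], as the group algebra of Z over F_r[y]: the monomial q p^j
   is [gmon j q]. *)
Definition laurent := galg int {poly Fr}.
HB.instance Definition _ := GRing.ComNzRing.on laurent.

Definition target_poly : {poly laurent} :=
  'X^(mac_e r) - (gmon (mac_h r) 'X : laurent)%:P.

(* F_r[y, p, p^-1][x] with x^(e_r) = p^(h_r) y.  [{poly %/ h}] is the quotient by
   (h) for h monic of positive degree, which holds here since e_r >= 1; see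
   [target_xE]. *)
Definition target := {poly %/ target_poly}.
HB.instance Definition _ := GRing.ComNzRing.on target.

Definition target_of_laurent (q : laurent) : target := in_qpoly target_poly q%:P.
Definition target_scalar (a : Fr) : target := target_of_laurent (gmon 0 a%:P).
Definition target_y : target := target_of_laurent (gmon 0 'X).
Definition target_p (j : int) : target := target_of_laurent (gmon j 1).
Definition target_x : target := in_qpoly target_poly 'X.

Lemma target_xE : (0 < mac_e r)%N ->
  target_x ^+ mac_e r = target_p (mac_h r) * target_y.
Proof.
move=> e0; have hM : target_poly \is monic by rewrite monicXnsubC.
have hE : mk_monic target_poly = target_poly.
  by rewrite /mk_monic hM size_XnsubC // ltnS e0.
rewrite -rmorphXn -rmorphM -polyCM gmonM addr0 mul1r.
apply/eqP; rewrite -subr_eq0 -rmorphB; apply/eqP/val_inj.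
by rewrite /= hE -/target_poly Pdiv.RingMonic.rmodpp.
Qed.

(* The homogeneous elements of degree al, for the grading with deg y = 0,
   deg p = 1 / e(mu_{r-1}) and deg x = lambda_r. *)
Definition target_component (al : rat) (u : target) : Prop :=
  exists (n : nat) (a : 'I_n -> Fr) (i k : 'I_n -> nat) (j : 'I_n -> int),
    (forall t, (j t)%:~R / (vram (mac_prev r))%:R + (k t)%:R * lam r = al) /\
    u = \sum_(t < n) target_scalar (a t) * target_y ^+ i t * target_p (j t)
                       * target_x ^+ k t.

End MacLaneData.

Arguments mac_F {K v r} c i _.
Arguments varphi_Delta {K v} pi {r} c i al u.

(* G is the internal direct sum of its subsets W al, al ranging over I. *)
Definition internal_direct_sum (T : choiceType) (G : zmodType)
    (I : T -> Prop) (W : T -> G -> Prop) : Prop :=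
  (forall u : G, exists (s : seq T) (w : T -> G),
     [/\ uniq s, forall al, al \in s -> I al /\ W al (w al)
       & u = \sum_(al <- s) w al]) /\
  (forall (s : seq T) (w : T -> G), uniq s ->
     (forall al, al \in s -> I al /\ W al (w al)) ->
     \sum_(al <- s) w al = 0 -> forall al, al \in s -> w al = 0).

(* Main.v *)
(** Write phi for the last key polynomial of the chain ([x] when r = 0).
    Residues modulo phi behave multiplicatively for mu, so the classes of the
    polynomials of degree < deg phi form a graded subring R of Gr(mu) in which
    every nonzero homogeneous element is a unit, and phi-expansions exhibit
    Gr(mu) as the polynomial ring R[H(phi)].  The degree-zero part of R is F_r
    and the recursion for pi_i produces a unit p of R whose degree generates
    the degrees of R, whence R = F_r[p, p^-1].  Replacing H(phi) by its
    multiple x by a unit of R, the monomials p^j x^k form an F_r-basis of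
    Gr(mu).  In the presentation, y stands for x^e p^-h, and
    y^i p^j x^k with k < e is sent to p^(j - h i) x^(e i + k); coprimality of
    h and e makes this compatible with the decomposition by varphi_r(alpha). *)

From HB Require Import structures.
Require Import Defs.
From mathcomp Require Import all_boot all_order all_algebra.
From mathcomp Require Import fraction boolp finmap monalg.
From mathcomp Require Import zify ring.

Set Implicit Arguments.
Unset Strict Implicit.
Unset Printing Implicit Defensive.

Import Order.TTheory GRing.Theory Num.Theory.
Local Open Scope ring_scope.

(** * Homogeneous components *)

(** The obstacle is arithmetical. The numbers e_i, h_i and V_i are defined by integer division and
    numerators, so it must be proved that these quotients are exact and that h_i and e_i are
    coprime. Both facts are read off from p_i: a unit of degree 1/e(mu_{i-1}) in Gr(mu_i),
    represented by a polynomial, shows that e(mu_{i-1}) divides e(mu_i). But p_i is built from the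
    Bezout coefficients of the earlier stages, which already require coprimality there, so one
    induction along the chain has to carry everything. It also needs the earlier H(phi_j), j < i, to
    be units in Gr(mu_i), and this is where the condition distinguishing a MacLane chain enters. The
    algebraic independence of y and the equality of Delta with F_r[y] are not isolated as
    statements: they are contained in the spanning and freeness of the monomials p^j x^k, where the
    exponent of x is unrestricted and y is absorbed. *)

Section GradedComponents.
Variables (K : fieldType) (v : discrete_valuation K) (mu : extension_valuation v).
Implicit Types (al be : rat) (g h : {poly K}) (u w : Gr mu).

Lemma pol_gtW al g : g \in pol_gt mu al -> g \in pol_ge mu al.
Proof. by rewrite !inE => /orP[->//|/ltW ->]; rewrite orbT. Qed.

Lemma pol_geP g al : g != 0 -> (g \in pol_ge mu al) = (al <= mu g%:F).
Proof. by move=> /negPf g0; rewrite inE g0. Qed.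

Lemma pol_gtP g al : g != 0 -> (g \in pol_gt mu al) = (al < mu g%:F).
Proof. by move=> /negPf g0; rewrite inE g0. Qed.

Lemma vval_polM g h : g != 0 -> h != 0 -> mu (g * h)%:F = mu g%:F + mu h%:F.
Proof. by move=> g0 h0; rewrite tofracM vvalM ?tofrac_eq0. Qed.

Lemma vval_polX g n : g != 0 -> mu (g ^+ n)%:F = n%:R * mu g%:F.
Proof.
move=> g0; elim: n => [|n IHn]; first by rewrite tofrac1 vval1 mul0r.
by rewrite exprS vval_polM ?expf_neq0 // IHn -natr1 mulrDl mul1r addrC.
Qed.

Lemma pol_geMr phi g al : phi != 0 ->
  (g * phi \in pol_ge mu al) = (g \in pol_ge mu (al - mu phi%:F)).
Proof.
move=> phi0; rewrite !inE mulf_eq0 (negPf phi0) orbF.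
by have [//|g0 /=] := eqVneq g 0; rewrite vval_polM // lerBlDr.
Qed.

Lemma pol_gtMr phi g al : phi != 0 ->
  (g * phi \in pol_gt mu al) = (g \in pol_gt mu (al - mu phi%:F)).
Proof.
move=> phi0; rewrite !inE mulf_eq0 (negPf phi0) orbF.
by have [//|g0 /=] := eqVneq g 0; rewrite vval_polM // ltrBlDr.
Qed.

Lemma gr_class_poly0 al : gr_class mu al 0 = 0.
Proof.
by have := gr_classB (pol_ge0 mu al) (pol_ge0 mu al); rewrite !subrr.
Qed.

Lemma gr_classN al g : g \in pol_ge mu al -> gr_class mu al (- g) = - gr_class mu al g.
Proof.
by move=> gP; rewrite -sub0r gr_classB ?pol_ge0 // gr_class_poly0 sub0r.
Qed.

Lemma gr_classD al g h : g \in pol_ge mu al -> h \in pol_ge mu al ->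
  gr_class mu al (g + h) = gr_class mu al g + gr_class mu al h.
Proof.
by move=> gP hP; rewrite -{1}[h]opprK gr_classB ?pol_geN // gr_classN // opprK.
Qed.

Lemma gr_class_eq0 al g : g \in pol_ge mu al ->
  gr_class mu al g = 0 <-> g \in pol_gt mu al.
Proof.
by move=> gP; rewrite -(gr_class_poly0 al) gr_class_eq ?pol_ge0 // subr0.
Qed.

Lemma initial_formE g : g != 0 -> initial_form mu g = gr_class mu (mu g%:F) g.
Proof. by rewrite /initial_form => /negPf ->. Qed.

Lemma initial_form1 : initial_form mu 1 = 1.
Proof. by rewrite initial_formE ?oner_eq0 // tofrac1 vval1 gr_class1. Qed.

Lemma initial_form_neq0 g : g != 0 -> initial_form mu g != 0.
Proof.
move=> g0; rewrite initial_formE //; apply/eqP => /gr_class_eq0.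
by rewrite pol_ge_val pol_gtP // ltxx => /(_ isT).
Qed.

Lemma initial_formX g n : initial_form mu (g ^+ n) = initial_form mu g ^+ n.
Proof.
elim: n => [|n IHn]; first exact: initial_form1.
by rewrite !exprS initial_formM IHn.
Qed.

Lemma Gr_componentE al g : g \in pol_ge mu al -> Gr_component al (gr_class mu al g).
Proof. by exists g. Qed.

Lemma Gr_component0 al : Gr_component al (0 : Gr mu).
Proof. by exists 0; rewrite ?pol_ge0 // gr_class_poly0. Qed.

Lemma Gr_componentD al u w :
  Gr_component al u -> Gr_component al w -> Gr_component al (u + w).
Proof.
case=> [g gP ->] [h hP ->]; exists (g + h); first by rewrite pol_geD.
by rewrite gr_classD.
Qed.

Lemma Gr_component_sum al I (s : seq I) (P : pred I) (F : I -> Gr mu) :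
  (forall i, P i -> Gr_component al (F i)) -> Gr_component al (\sum_(i <- s | P i) F i).
Proof.
move=> FP; elim/big_ind: _ => //; first exact: Gr_component0.
exact: Gr_componentD.
Qed.

Lemma Gr_componentM al be u w :
  Gr_component al u -> Gr_component be w -> Gr_component (al + be) (u * w).
Proof.
by case=> [g gP ->] [h hP ->]; exists (g * h); rewrite ?pol_geM // gr_classM.
Qed.

Lemma Gr_component_initial g : Gr_component (mu g%:F) (initial_form mu g).
Proof.
rewrite /initial_form; case: eqP => _; first exact: Gr_component0.
by apply: Gr_componentE; rewrite pol_ge_val.
Qed.

Lemma Gr_component_neq0 al u : Gr_component al u -> u != 0 ->
  exists2 g, g != 0 & mu g%:F = al /\ u = initial_form mu g.
Proof.
case=> g gP -> /eqP u0; have g_al : ~~ (g \in pol_gt mu al).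
  by apply/negP => /gr_class_eq0 -/(_ gP).
have g0 : g != 0 by apply: contraNneq g_al => ->; exact: pol_gt0.
have E : mu g%:F = al.
  by apply/le_anti; rewrite leNgt -pol_gtP // g_al -pol_geP.
by exists g => //; split=> //; rewrite initial_formE // E.
Qed.

Lemma Gr_span u : exists (s : seq rat) (w : rat -> Gr mu),
  [/\ uniq s, forall al, Gr_component al (w al) & u = \sum_(al <- s) w al].
Proof.
elim/quotW: u => f; exists (msupp (val f)), (fun al => gr_class mu al (mcoeff al (val f))).
have fP : forall al, mcoeff al (val f) \in pol_ge mu al by apply/reesP/valP.
split=> [|al|]; [exact: fset_uniq | exact: Gr_componentE |].
have R al : gmon al (mcoeff al (val f)) \in rees_pred mu by rewrite gmon_rees.
under eq_bigr => al _ do rewrite (gr_class_rees (fP al) (R al)).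
rewrite -(rmorph_sum \pi_(Gr mu)%qT); congr (\pi_(_)%qT _).
by apply: val_inj; rewrite rmorph_sum [LHS]galgE.
Qed.

(** The sum lifts to the subring [rees], and membership in the ideal [rees_plus] is tested one
    coefficient at a time, so each summand vanishes separately. *)
Lemma Gr_direct (s : seq rat) (w : rat -> Gr mu) : uniq s ->
  (forall al, al \in s -> Gr_component al (w al)) ->
  \sum_(al <- s) w al = 0 -> forall al, al \in s -> w al = 0.
Proof.
move=> s_uniq wP w0 al als.
have /choice [g gP] : forall be, exists g, g \in pol_ge mu be /\
    (be \in s -> w be = gr_class mu be g).
  move=> be; have [/wP [g gb ->]|_] := boolP (be \in s); first by exists g.
  by exists 0; rewrite pol_ge0.
have R be : gmon be (g be) \in rees_pred mu by rewrite gmon_rees; case: (gP be).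
have E : \sum_(be <- s) w be = \pi_(Gr mu)%qT (\sum_(be <- s) Rees (R be)).
  rewrite (rmorph_sum \pi_(Gr mu)%qT) [LHS]big_seq [RHS]big_seq.
  apply: eq_bigr => be bes.
  by case: (gP be) => gb /(_ bes) ->; rewrite (gr_class_rees gb (R be)).
have /gr_eqP : \pi_(Gr mu)%qT (\sum_(be <- s) Rees (R be)) = \pi_(Gr mu)%qT 0.
  by rewrite -E w0 rmorph0.
rewrite subr0 => /rees_plusP /(_ al); rewrite rmorph_sum /=.
have -> : mcoeff al (\sum_(be <- s) gmon be (g be) : galg rat {poly K}) = g al.
  rewrite raddf_sum (bigD1_seq al) //= mcoeffUU big1 ?addr0 // => be ne.
  by rewrite [LHS]mcoeffU (negPf ne).
by case: (gP al) => ga /(_ als) -> /gr_class_eq0 ->.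
Qed.

End GradedComponents.

(** * Residues modulo a polynomial *)

(* The only properties of mu and phi from which the structure of Gr(mu) is
   derived; they hold for (mu_0, x) and for (mu', phi) whenever mu' is an
   augmentation [mu; (phi, lam)]. *)
Definition division_compatible (K : fieldType) (v : discrete_valuation K)
    (mu : extension_valuation v) (phi : {poly K}) : Prop :=
  [/\ phi \is monic, (1 < size phi)%N,
      forall al g, g \in pol_ge mu al -> g %% phi \in pol_ge mu al,
      forall a b : {poly K}, a != 0 -> b != 0 ->
        (size a < size phi)%N -> (size b < size phi)%N ->
        a * b - (a * b) %% phi \in pol_gt mu (mu (a * b)%:F)
    & forall a : {poly K}, a != 0 -> (size a < size phi)%N -> coprimep a phi].

Section SmallResidues.
Variables (K : fieldType) (v : discrete_valuation K) (mu : extension_valuation v).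
Variables (phi : {poly K}) (div_phi : division_compatible mu phi).
Implicit Types (al be : rat) (g h : {poly K}) (u w : Gr mu).

Let phi_monic : phi \is monic. Proof. by case: div_phi. Qed.
Let phi_gt1 : (1 < size phi)%N. Proof. by case: div_phi. Qed.
Let phi_neq0 : phi != 0. Proof. exact: monic_neq0. Qed.

(** The part of degree [al] of the subring R of the overview. The representative may have value
    greater than [al]; its class is then 0. *)
Definition small_class al u : Prop :=
  exists a : {poly K}, [/\ (size a < size phi)%N, a \in pol_ge mu al & u = gr_class mu al a].

Definition small_unit al u : Prop := small_class al u /\ u \is a GRing.unit.

Lemma small_class_comp al u : small_class al u -> Gr_component al u.
Proof. by case=> a [_ aP ->]; exists a. Qed.

Lemma small_class0 al : small_class al 0.
Proof.
by exists 0; rewrite size_poly0 (ltnW phi_gt1) pol_ge0 gr_class_poly0.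
Qed.

Lemma small_classD al u w :
  small_class al u -> small_class al w -> small_class al (u + w).
Proof.
case=> [a [a_lt aP ->]] [b [b_lt bP ->]]; exists (a + b); split.
- by rewrite (leq_ltn_trans (size_polyD _ _)) // gtn_max a_lt.
- exact: pol_geD.
- by rewrite gr_classD.
Qed.

Lemma small_class_sum al I (s : seq I) (P : pred I) (F : I -> Gr mu) :
  (forall i, P i -> small_class al (F i)) ->
  small_class al (\sum_(i <- s | P i) F i).
Proof.
by move=> FP; elim/big_ind: _ => //; [exact: small_class0|exact: small_classD].
Qed.

Lemma small_class1 : small_class 0 1.
Proof. by exists 1; rewrite size_poly1 phi_gt1 pol_ge1 gr_class1. Qed.

(** Reducing the product modulo [phi] restores the degree bound, and by the fourth clause of
    [division_compatible] it changes the product only by terms of larger value. *)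
Lemma small_classM al be u w :
  small_class al u -> small_class be w -> small_class (al + be) (u * w).
Proof.
case: div_phi => _ _ div_ge div_gt _ [a [a_lt aP ->]] [b [b_lt bP ->]].
have [->|a0] := eqVneq a 0; first by rewrite gr_class_poly0 mul0r; exact: small_class0.
have [->|b0] := eqVneq b 0; first by rewrite gr_class_poly0 mulr0; exact: small_class0.
have abP := pol_geM aP bP; exists (a * b %% phi); split.
- by rewrite ltn_modp.
- exact: div_ge.
- rewrite -(gr_classM aP bP); apply/(gr_class_eq abP (div_ge _ _ abP)).
  have := div_gt a b a0 b0 a_lt b_lt; rewrite !inE => /orP[->//|lt_ab].
  by apply/orP; right; apply: le_lt_trans lt_ab; rewrite -pol_geP ?mulf_neq0.
Qed.

Lemma small_class_neq0 al u : small_class al u -> u != 0 ->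
  exists2 a : {poly K}, a != 0 /\ (size a < size phi)%N & mu a%:F = al /\ u = initial_form mu a.
Proof.
case=> a [a_lt aP ->] u0.
have a0 : a != 0 by apply: contraNneq u0 => ->; rewrite gr_class_poly0.
exists a => //; rewrite /initial_form (negPf a0); suff -> : mu a%:F = al by [].
apply/le_anti; rewrite -pol_geP // aP andbT leNgt -pol_gtP //.
by apply: contra u0 => aP'; apply/eqP/gr_class_eq0.
Qed.

(** A Bezout relation gives b with a b congruent to 1 modulo [phi]. The residue of a b is then 1,
    and compatibility with division forces a b and 1 to have the same value and the same initial
    form. *)
Lemma small_class_inv al u : small_class al u -> u != 0 ->
  exists2 w, small_class (- al) w & w * u = 1.
Proof.
case: div_phi => _ _ _ div_gt div_co su u0.
have [a [a0 a_lt] [a_al ->]] := small_class_neq0 su u0.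
have /Bezout_eq1_coprimepP [[b c] /= bc1] := div_co a a0 a_lt.
have mod1 : (a * (b %% phi)) %% phi = 1.
  have <- : 1 %% phi = 1 by rewrite modp_small ?size_poly1.
  by rewrite modp_mul mulrC -bc1 modpD modp_mull addr0.
have b0 : b %% phi != 0.
  by apply: contra_eq_neq mod1 => ->; rewrite mulr0 mod0p eq_sym oner_neq0.
have b_lt : (size (b %% phi)%R < size phi)%N by rewrite ltn_modp.
have ab0 : a * (b %% phi) != 0 by rewrite mulf_neq0.
have := div_gt _ _ a0 b0 a_lt b_lt; rewrite mod1 => ab1.
have v_ab : mu (a * (b %% phi))%:F = 0.
  have ge1 : 1 \in pol_ge mu (mu (a * (b %% phi))%:F).
    rewrite -[1](subKr (a * (b %% phi))) pol_geD ?pol_ge_val //.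
    by rewrite pol_geN // pol_gtW.
  move: (ge1); rewrite pol_geP ?oner_eq0 // tofrac1 vval1 le_eqVlt => /orP[/eqP//|lt0].
  have gt1 : 1 \in pol_gt mu (mu (a * (b %% phi))%:F).
    by rewrite pol_gtP ?oner_eq0 // tofrac1 vval1.
  by have := pol_gtD ab1 gt1; rewrite subrK pol_gtP // ltxx.
have v_b : mu (b %% phi)%:F = - al.
  by apply/eqP; rewrite -addr_eq0 addrC -a_al -vval_polM ?v_ab.
exists (initial_form mu (b %% phi)).
  exists (b %% phi); split; first exact: b_lt.
    by rewrite -v_b pol_ge_val.
  by rewrite initial_formE // v_b.
rewrite -initial_formM mulrC initial_formE // v_ab -gr_class1.
by apply/gr_class_eq; rewrite ?pol_ge1 // -?v_ab ?pol_ge_val.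
Qed.

Lemma small_class_unit al u : small_class al u -> u != 0 -> small_unit al u.
Proof.
move=> su u0; split=> //; have [w _ wu] := small_class_inv su u0.
by apply/unitrPr; exists w; rewrite mulrC.
Qed.

Lemma small_unit_neq0 al u : small_unit al u -> u != 0.
Proof. by case=> _; apply: contraTneq => ->; rewrite unitr0. Qed.

Lemma small_unitM al be u w :
  small_unit al u -> small_unit be w -> small_unit (al + be) (u * w).
Proof.
by move=> [su uu] [sw uw]; split; [exact: small_classM|rewrite unitrM uu].
Qed.

Lemma small_unitV al u : small_unit al u -> small_unit (- al) u^-1.
Proof.
move=> uu; have [w sw wu] := small_class_inv (proj1 uu) (small_unit_neq0 uu).
case: uu => su uu; split; last by rewrite unitrV.
by rewrite -[u^-1]mul1r -wu mulrK.
Qed.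

Lemma small_unit1 : small_unit 0 1.
Proof. by split; [exact: small_class1|exact: unitr1]. Qed.

Lemma small_unitX al u n : small_unit al u -> small_unit (n%:R * al) (u ^+ n).
Proof.
move=> uu; elim: n => [|n IHn]; first by rewrite mul0r; exact: small_unit1.
by rewrite exprSr -natr1 mulrDl mul1r; exact: small_unitM.
Qed.

Lemma small_unitXz al u (z : int) : small_unit al u -> small_unit (z%:~R * al) (u ^ z).
Proof.
move=> uu; case: z => n; first exact: small_unitX.
by rewrite NegzE mulrNz mulNr -exprnN; apply/small_unitV/small_unitX.
Qed.

Lemma small_unit_initial (a : {poly K}) : a != 0 -> (size a < size phi)%N ->
  small_unit (mu a%:F) (initial_form mu a).
Proof.
move=> a0 a_lt; apply: small_class_unit; last exact: initial_form_neq0.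
by exists a; rewrite pol_ge_val initial_formE.
Qed.

Lemma comp_expand al u : Gr_component al u ->
  exists N (w : nat -> Gr mu),
    (forall n, small_class (al - n%:R * mu phi%:F) (w n)) /\
    u = \sum_(n < N) w n * initial_form mu phi ^+ n.
Proof.
case: div_phi => _ _ div_ge _ _ [g gP ->].
have [M] := ubnP (size g); elim: M => // M IHM in g al gP *; rewrite ltnS => gM.
have [->|g0] := eqVneq g 0.
  exists 0%N, (fun=> 0); split; first by move=> n; exact: small_class0.
  by rewrite big_ord0 gr_class_poly0.
have q_lt : (size (g %/ phi)%R < M)%N.
  rewrite size_divp //; apply: leq_trans gM.
  by rewrite ltn_subrL size_poly_gt0 g0 andbT; case: (size phi) phi_gt1 => [|[]].
have gmod := div_ge _ _ gP.
have gdiv : (g %/ phi) * phi \in pol_ge mu al.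
  have -> : (g %/ phi) * phi = g - g %% phi by rewrite {2}(divp_eq g phi) addrK.
  by rewrite pol_geD ?pol_geN.
have qP : g %/ phi \in pol_ge mu (al - mu phi%:F) by rewrite -pol_geMr.
have [N [w [wP wE]]] := IHM _ _ qP q_lt.
exists N.+1, (fun n => if n is m.+1 then w m else gr_class mu al (g %% phi)); split.
  case=> [|n]; first by rewrite mul0r subr0; exists (g %% phi); rewrite ltn_modp phi_neq0.
  have -> : al - n.+1%:R * mu phi%:F = al - mu phi%:F - n%:R * mu phi%:F by ring.
  exact: wP.
rewrite big_ord_recl /= expr0 mulr1 {1}(divp_eq g phi) (gr_classD gdiv gmod) addrC.
congr (_ + _); rewrite -[X in gr_class _ X _](subrK (mu phi%:F)).
rewrite gr_classM ?pol_ge_val // -initial_formE // wE mulr_suml.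
by apply: eq_bigr => n _; rewrite -mulrA -exprSr.
Qed.

(** Lifting the coefficients to small polynomials gives a phi-expansion whose sum has value greater
    than [al]. The auxiliary fact [key] passes this strict bound to each term, by splitting off the
    remainder modulo [phi] and dividing the rest by [phi]. *)
Lemma comp_free al N (w : nat -> Gr mu) :
  (forall n, (n < N)%N -> small_class (al - n%:R * mu phi%:F) (w n)) ->
  \sum_(n < N) w n * initial_form mu phi ^+ n = 0 ->
  forall n, (n < N)%N -> w n = 0.
Proof.
case: div_phi => _ _ div_ge _ _.
have key (M : nat) be (f : nat -> {poly K}) :
    (forall n, (n < M)%N -> (size (f n) < size phi)%N) ->
    \sum_(n < M) f n * phi ^+ n \in pol_gt mu be ->
    forall n, (n < M)%N -> f n \in pol_gt mu (be - n%:R * mu phi%:F).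
  elim: M be f => // M IHM be f f_lt; rewrite big_ord_recl /= expr0 mulr1.
  under eq_bigr do rewrite /bump /= add1n exprSr mulrA.
  rewrite -mulr_suml; set q := \sum_(n < M) _ => gP.
  have f0P : f 0%N \in pol_gt mu be.
    have Emod : (f 0%N + q * phi) %% phi = f 0%N.
      by rewrite modpD modp_mull addr0 modp_small // f_lt.
    have [g0|g0] := eqVneq (f 0%N + q * phi) 0.
      by move: Emod; rewrite g0 mod0p => <-; rewrite pol_gt0.
    (* [div_ge] preserves only non-strict bounds; taken at the exact value of the sum, which exceeds
       [be], it yields the strict one. *)
    have := div_ge _ _ (pol_ge_val mu (f 0%N + q * phi)); rewrite Emod.
    move: gP; rewrite pol_gtP // => lt_be; rewrite !inE => /orP[->//|le_f].
    by rewrite (lt_le_trans lt_be le_f) orbT.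
  have qP : q * phi \in pol_gt mu be.
    by rewrite -[q * phi](addKr (f 0%N)) pol_gtD ?pol_gtN.
  case=> [|n]; first by rewrite mul0r subr0.
  have -> : be - n.+1%:R * mu phi%:F = be - mu phi%:F - n%:R * mu phi%:F by ring.
  rewrite ltnS => nM.
  by apply: (IHM _ (fun m => f m.+1)) => // [m mM|]; [rewrite f_lt|rewrite -pol_gtMr].
move=> wP w0.
have /choice [f fP] : forall n, exists a : {poly K}, (n < N)%N ->
    [/\ (size a < size phi)%N, a \in pol_ge mu (al - n%:R * mu phi%:F)
      & w n = gr_class mu (al - n%:R * mu phi%:F) a].
  by move=> n; case: (ltnP n N) => [/wP [a aP]|_]; [exists a|exists 0].
have fXP n : (n < N)%N -> f n * phi ^+ n \in pol_ge mu al.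
  case/fP => _ fn _; rewrite -[al](subrK (n%:R * mu phi%:F)) pol_geM //.
  by rewrite -vval_polX // pol_ge_val.
have sumP M : (M <= N)%N -> \sum_(n < M) f n * phi ^+ n \in pol_ge mu al /\
   gr_class mu al (\sum_(n < M) f n * phi ^+ n) =
   \sum_(n < M) w n * initial_form mu phi ^+ n.
  elim: M => [|M IHM] MN; first by rewrite !big_ord0 pol_ge0 gr_class_poly0.
  rewrite !big_ord_recr /=; have [gP gE] := IHM (ltnW MN).
  have [_ fM wM] := fP _ MN; have fM' := fM; rewrite -vval_polX // in fM'.
  split; first by rewrite pol_geD ?fXP.
  rewrite (gr_classD gP (fXP _ MN)) gE; congr (_ + _).
  rewrite -{1}[al](subrK (M%:R * mu phi%:F)) -vval_polX //.
  rewrite (gr_classM fM' (pol_ge_val mu (phi ^+ M))).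
  by rewrite vval_polX // -wM -initial_formX initial_formE ?expf_neq0 ?vval_polX.
have [gP gE] := sumP _ (leqnn N).
have g_gt : \sum_(n < N) f n * phi ^+ n \in pol_gt mu al.
  by apply/gr_class_eq0 => //; rewrite gE.
move=> n nN; have [_ fn ->] := fP n nN; apply/gr_class_eq0 => //.
by apply: (key N) => // m /fP [].
Qed.
End SmallResidues.

(** * Monomials *)

Lemma sum_fibers (V : nmodType) (I J : eqType) (s : seq I) (f : I -> J) (F : I -> V) :
  \sum_(i <- s) F i = \sum_(j <- undup (map f s)) \sum_(i <- s | f i == j) F i.
Proof.
under [RHS]eq_bigr do rewrite big_mkcond /=.
rewrite exchange_big /= [LHS]big_seq [RHS]big_seq; apply: eq_bigr => i si.
rewrite (bigD1_seq (f i)) ?undup_uniq ?mem_undup ?map_f //= eqxx.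
by rewrite big1 ?addr0 // => j; rewrite eq_sym => /negPf ->.
Qed.

Section HomogeneousMonomials.
Variables (K : fieldType) (v : discrete_valuation K) (mu : extension_valuation v).
Variables (phi : {poly K}) (div_phi : division_compatible mu phi).
Variables (lam : rat) (e : nat) (x p om : Gr mu).
Hypothesis om_unit : small_unit phi (lam - mu phi%:F) om.
Hypothesis xE : x = initial_form mu phi * om.
Hypothesis e_gt0 : (0 < e)%N.
Hypothesis p_unit : small_unit phi e%:R^-1 p.
Hypothesis e_int : forall a : {poly K}, a != 0 -> (size a < size phi)%N ->
  exists z : int, e%:R * mu a%:F = z%:~R.
Implicit Types (al be : rat) (u w : Gr mu).
Local Notation small_class := (small_class (mu := mu) phi).
Local Notation small_unit := (small_unit (mu := mu) phi).

(** The degree of p^j x^k. In this section [e] stands for e(mu_{r-1}), not for e_r. *)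
Definition monomial_degree (k : nat) (j : int) : rat := j%:~R / e%:R + k%:R * lam.

Lemma x_comp : Gr_component lam x.
Proof.
rewrite xE -[lam](addrNK (mu phi%:F)) addrC; apply: Gr_componentM.
  exact: Gr_component_initial.
by case: om_unit => /small_class_comp.
Qed.

Lemma Gr_componentX al u n : Gr_component al u -> Gr_component (n%:R * al) (u ^+ n).
Proof.
move=> uP; elim: n => [|n IHn].
  by rewrite mul0r; exists 1; rewrite ?pol_ge1 ?gr_class1.
by rewrite exprSr -natr1 mulrDl mul1r; apply: Gr_componentM.
Qed.

Lemma p_pow (j : int) : small_unit (j%:~R / e%:R) (p ^ j).
Proof. exact: (small_unitXz div_phi _ p_unit). Qed.

Lemma monomial_comp (a : Gr mu) k j : small_class 0 a ->
  Gr_component (monomial_degree k j) (a * p ^ j * x ^+ k).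
Proof.
move=> aP; apply: Gr_componentM; last exact/Gr_componentX/x_comp.
rewrite -[_ / _]add0r; apply: Gr_componentM; first exact: small_class_comp aP.
by case: (p_pow j) => /small_class_comp.
Qed.

(** By [e_int] the degree of a non-zero small class is a multiple of that of the unit [p], so
    dividing by a power of [p] brings it to degree 0. *)
Lemma small_class_monomial al u : small_class al u -> u != 0 ->
  exists j a, [/\ al = j%:~R / e%:R, small_class 0 a & u = a * p ^ j].
Proof.
move=> su u0; have [a [a0 a_lt] [a_al uE]] := small_class_neq0 su u0.
have [j jE] := e_int a0 a_lt; exists j, (u * p ^ (- j)).
have alE : al = j%:~R / e%:R.
  by rewrite -a_al -jE mulrAC divff ?mul1r // pnatr_eq0 -lt0n.
split=> //.
  rewrite -(subrr al) {2}alE; apply: (small_classM div_phi) => //.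
  by have [] := p_pow (- j); rewrite rmorphN mulNr.
have [_ up] := p_unit.
by rewrite -mulrA -exprzDr // addNr expr0z mulr1.
Qed.

Lemma x_expand al u : Gr_component al u ->
  exists N (w : nat -> Gr mu), (forall n, small_class (al - n%:R * lam) (w n)) /\
    u = \sum_(n < N) w n * x ^+ n.
Proof.
case/(comp_expand div_phi) => N [w [wP ->]].
have [_ uom] := om_unit.
exists N, (fun n => w n * om ^- n); split.
  move=> n.
  have -> : al - n%:R * lam = al - n%:R * mu phi%:F - n%:R * (lam - mu phi%:F) by ring.
  apply: (small_classM div_phi) => //.
  by have [] := small_unitV div_phi (small_unitX div_phi n om_unit).
apply: eq_bigr => n _.
by rewrite xE exprMn [_ * om ^+ n]mulrC mulrA mulrVK // unitrX.
Qed.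

Lemma x_free al N (w : nat -> Gr mu) :
  (forall n, (n < N)%N -> small_class (al - n%:R * lam) (w n)) ->
  \sum_(n < N) w n * x ^+ n = 0 -> forall n, (n < N)%N -> w n = 0.
Proof.
have [_ uom] := om_unit.
move=> wP w0 n nN; apply: (mulIr (unitrX n uom)); rewrite mul0r.
apply: (comp_free div_phi (al := al) (N := N) (w := fun n => w n * om ^+ n)) => //.
  move=> m mN.
  have -> : al - m%:R * mu phi%:F = al - m%:R * lam + m%:R * (lam - mu phi%:F) by ring.
  apply: (small_classM div_phi); first exact: wP.
  by have [] := small_unitX div_phi m om_unit.
rewrite -[RHS]w0; apply: eq_bigr => m _.
by rewrite xE exprMn -mulrA [om ^+ m * _]mulrC.
Qed.

Lemma monomial_span al u : Gr_component al u ->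
  exists s : seq (Gr mu * (nat * int)),
    (forall q, q \in s -> small_class 0 q.1 /\ monomial_degree q.2.1 q.2.2 = al) /\
    u = \sum_(q <- s) q.1 * p ^ q.2.2 * x ^+ q.2.1.
Proof.
case/x_expand => N [w [wP ->]]; elim: N => [|N [s [sP sE]]].
  by exists [::]; rewrite big_nil big_ord0.
rewrite big_ord_recr /= sE.
have [w0|w0] := eqVneq (w N) 0; first by exists s; rewrite w0 mul0r addr0.
have [j [a [alE aP wE]]] := small_class_monomial (wP N) w0.
exists ((a, (N, j)) :: s); split.
  move=> q; rewrite in_cons => /orP[/eqP ->|/sP //]; split=> //=.
  by rewrite /monomial_degree -alE subrK.
by rewrite big_cons addrC wE.
Qed.

(** The grading isolates the monomials of one degree. Among these, collecting equal powers of [x]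
    reduces the claim to [x_free], and each power of [x] occurs at most once. *)
Lemma monomial_free (s : seq (nat * int)) (b : nat * int -> Gr mu) : uniq s ->
  (forall q, q \in s -> small_class 0 (b q)) ->
  \sum_(q <- s) b q * p ^ q.2 * x ^+ q.1 = 0 -> forall q, q \in s -> b q = 0.
Proof.
move=> s_uniq bP.
pose deg (q : nat * int) := monomial_degree q.1 q.2.
rewrite (sum_fibers s deg) => /Gr_direct sum0 [n j] nj_s.
have {sum0} := sum0 (undup_uniq _) _ (deg (n, j)); rewrite mem_undup map_f //.
set al := deg (n, j); move=> sum_al.
have {sum_al} : \sum_(q <- s | deg q == al) b q * p ^ q.2 * x ^+ q.1 = 0.
  apply: sum_al => // be _; rewrite big_seq_cond; apply: Gr_component_sum.
  by move=> q /andP[qs /eqP <-]; apply/monomial_comp/bP.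
pose N := (\max_(q <- s) q.1).+1.
have ltN q : q \in s -> (q.1 < N)%N.
  by move=> qs; rewrite ltnS; exact: (leq_bigmax_seq (F := fun q : nat * int => q.1) q qs isT).
pose w m := \sum_(q <- s | (deg q == al) && (q.1 == m)) b q * p ^ q.2.
rewrite big_seq_cond (partition_big (fun q : nat * int => inord q.1 : 'I_N) xpredT) //= => sum0.
have {sum0} sum0 : \sum_(m < N) w m * x ^+ m = 0.
  rewrite -[RHS]sum0; apply: eq_bigr => m _; rewrite mulr_suml.
  rewrite [LHS]big_seq_cond; apply: eq_big => q.
    case qs: (q \in s) => //=; congr (_ && _).
    by rewrite -val_eqE /= inordK // ltN.
  by case/and3P => _ _ /eqP ->.
have w0 : w n = 0.
  apply: (x_free (al := al) _ sum0); last exact: (ltN _ nj_s).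
  move=> m _; rewrite /w big_seq_cond; apply: (small_class_sum div_phi) => q.
  case/and3P => qs /eqP <- /eqP <-.
  rewrite /deg /monomial_degree addrK -[_ / _]add0r.
  by apply: (small_classM div_phi); [exact: bP|have [] := p_pow q.2].
have e0 : e%:R != 0 :> rat by rewrite pnatr_eq0 -lt0n.
(* The degree and the exponent of [x] determine the exponent of [p], so [w n] consists of a single
   term. *)
have E q : q \in s -> (deg q == al) && (q.1 == n) = (q == (n, j)).
  move=> _; case: q => m k /=; apply/andP/eqP => [[/eqP dk /eqP mn]|[-> ->]]; last by rewrite !eqxx.
  move: dk; rewrite /deg /al /monomial_degree /= mn => /addIr /(divIf e0) /eqP.
  by rewrite eqr_int => /eqP ->.
have [_ up] := p_unit; apply: (mulIr (unitrXz j up)); rewrite mul0r -w0 /w.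
rewrite big_seq_cond (eq_bigl (fun q => (q \in s) && (q == (n, j)))).
  by rewrite -big_seq_cond -big_filter filter_pred1_uniq // big_seq1.
by move=> q; case qs: (q \in s) => //=; exact: E.
Qed.
End HomogeneousMonomials.

(** * Key polynomials and augmentations *)

Section InitialForms.
Variables (K : fieldType) (v : discrete_valuation K) (mu : extension_valuation v).
Implicit Types (al be : rat) (g h phi psi : {poly K}).

Lemma initial_form_congr g h : g != 0 -> g - h \in pol_gt mu (mu g%:F) ->
  [/\ h != 0, mu h%:F = mu g%:F & initial_form mu h = initial_form mu g].
Proof.
move=> g0 ghP.
have h0 : h != 0.
  by apply: contraTneq ghP => ->; rewrite subr0 pol_gtP // ltxx.
have hP : h \in pol_ge mu (mu g%:F).
  by rewrite -[h](subKr g) pol_geD ?pol_ge_val // pol_geN // pol_gtW.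
have E : mu h%:F = mu g%:F.
  apply/le_anti; rewrite -[X in _ && X](pol_geP _ _ h0) hP andbT leNgt -pol_gtP //.
  apply: contraL ghP => hP'; apply/negP => ghP.
  by have := pol_gtD ghP hP'; rewrite subrK pol_gtP // ltxx.
split; [exact: h0 | exact: E |].
rewrite (initial_formE mu g0) (initial_formE mu h0) E; apply/esym.
by apply/(gr_class_eq (pol_ge_val mu g) hP).
Qed.

End InitialForms.

Section KeyPolynomials.
Variables (K : fieldType) (v : discrete_valuation K) (mu : extension_valuation v).
Implicit Types (al be : rat) (g h phi psi : {poly K}).

Section Key.
Variables (phi : {poly K}) (key_phi : key_polynomial mu phi).

Lemma key_monic : phi \is monic. Proof. by case: key_phi. Qed.
Lemma key_gt1 : (1 < size phi)%N. Proof. by case: key_phi. Qed.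
Lemma key_neq0 : phi != 0. Proof. exact: monic_neq0 key_monic. Qed.

Lemma key_minimal g : g != 0 -> (size g < size phi)%N -> ~ gr_dvd mu phi g.
Proof. by case: key_phi => _ _ _; apply. Qed.

Lemma key_not_unit : initial_form mu phi \isn't a GRing.unit.
Proof.
have [_ _ [_ [_ proper _] _] _] := key_phi.
apply/unitrPr => -[w w1]; apply: (negP proper); rewrite inE; apply/asboolP.
by exists w.
Qed.

Lemma unit_not_dvd g : initial_form mu g \is a GRing.unit -> ~ gr_dvd mu phi g.
Proof. by move=> gU [u gE]; case/negP: key_not_unit; rewrite gE unitrM in gU; case/andP: gU. Qed.

Lemma key_prime g h : gr_dvd mu phi (g * h) -> gr_dvd mu phi g \/ gr_dvd mu phi h.
Proof.
have [_ _ [_ _ prime_phi] _] := key_phi.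
move=> [u ghE]; rewrite initial_formM in ghE.
have /prime_phi : initial_form mu g * initial_form mu h
    \in principal_ideal (initial_form mu phi) by rewrite inE; apply/asboolP; exists u.
by rewrite !inE => /orP[] /asboolP dvd_phi; [left|right].
Qed.

(** Let d be the gcd. Primality makes H(phi) divide the initial form of d or of phi / d. Minimality
    rules out d, and then forces phi / d to have full degree, so d is constant. *)
Lemma key_coprime g : g != 0 -> (size g < size phi)%N -> coprimep g phi.
Proof.
move=> g0 g_lt; rewrite /coprimep; set d := gcdp g phi.
have d0 : d != 0 by rewrite gcdp_eq0 negb_and g0.
have d_lt : (size d < size phi)%N.
  by apply: leq_ltn_trans g_lt; apply: dvdp_leq => //; exact: dvdp_gcdl.
have phiE : phi = phi %/ d * d by rewrite divpK // dvdp_gcdr.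
have q0 : phi %/ d != 0.
  by apply: contraNneq key_neq0 => q0; rewrite phiE q0 mul0r.
have : gr_dvd mu phi (phi %/ d * d) by exists 1; rewrite -phiE mulr1.
case/key_prime => [|/(key_minimal d0 d_lt)//].
have [q_lt /(key_minimal q0 q_lt)//|phi_le _] := ltnP (size (phi %/ d)) (size phi).
move: phi_le; rewrite {1}phiE size_mul // => le_q.
have: (0 < size d)%N by rewrite size_poly_gt0.
by case: (size d) le_q => [|[|n]] //; rewrite !addnS /= ltnNge leq_addr.
Qed.

(** The remainder is the zeroth term of a phi-expansion of [g], and [key_expansion_ge] bounds every
    term. *)
Lemma key_mod_ge al g : g \in pol_ge mu al -> g %% phi \in pol_ge mu al.
Proof.
have [c cP gE] := phi_expansion (g %/ phi) key_monic key_gt1.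
have c'P : all (fun a : {poly K} => size a < size phi)%N ((g %% phi) :: c).
  by rewrite /= ltn_modp key_neq0.
move=> gP; have := key_expansion_ge key_phi (al := al) c'P.
rewrite big_ord_recl /= expr0 mulr1.
under eq_bigr do rewrite /bump /= add1n exprSr mulrA.
rewrite -mulr_suml -gE addrC -divp_eq => /(_ gP 0%N).
by rewrite /= expr0 mulr1.
Qed.

(** Smaller degree is excluded by minimality. For equal degrees the difference [d] of the two monic
    polynomials has smaller degree, so H(phi) cannot divide H(d), and comparing the values of [d]
    and [psi] contradicts this or the non-equivalence. *)
Lemma key_not_dvd_prev psi : psi \is monic -> (size psi <= size phi)%N ->
  ~ gr_equiv mu phi psi -> ~ gr_dvd mu phi psi.
Proof.
move=> psi_monic; rewrite leq_eqVlt => /orP[/eqP eq_size|lt_size] nequiv; last first.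
  by apply: key_minimal => //; exact: monic_neq0.
have psi0 := monic_neq0 psi_monic; have phi0 := key_neq0.
case=> w psiE; pose d := phi - psi.
have d0 : d != 0 by apply/eqP => /subr0_eq E; apply: nequiv; rewrite E.
have d_lt : (size d < size phi)%N.
  rewrite ltn_neqAle (leq_trans (size_polyD _ _)) ?andbT; last first.
    by rewrite size_polyN eq_size maxnn.
  apply/eqP => sd; move/eqP: d0; apply; apply/eqP.
  rewrite -lead_coef_eq0 lead_coefE sd coefB -{1}lead_coefE (monicP key_monic).
  by rewrite -eq_size -lead_coefE (monicP psi_monic) subrr.
have d_ndvd := key_minimal d0 d_lt.
have [lt_d|lt_d|eq_d] := ltgtP (mu d%:F) (mu psi%:F).
- case: d_ndvd; have [|_ _ dE] := initial_form_congr (mu := mu) (g := d) (h := phi) d0.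
    have -> : d - phi = - psi by rewrite /d addrAC subrr sub0r.
    by rewrite pol_gtN // pol_gtP.
  by exists 1; rewrite mulr1 dE.
- have [|_ _ E] := initial_form_congr (mu := mu) (g := psi) (h := phi) psi0.
    by rewrite -opprB pol_gtN // pol_gtP.
  exact: nequiv.
have phiP : phi \in pol_ge mu (mu psi%:F).
  by rewrite -[phi](subrK psi) pol_geD ?pol_ge_val // -eq_d pol_ge_val.
have dE : initial_form mu d = gr_class mu (mu psi%:F) phi - initial_form mu psi.
  by rewrite !initial_formE // eq_d gr_classB ?pol_ge_val.
apply: d_ndvd; have [phi_gt|phi_ngt] := boolP (phi \in pol_gt mu (mu psi%:F)).
  exists (- w); rewrite dE psiE mulrN.
  by have /gr_class_eq0 := phiP => -[_ ->] //; rewrite sub0r.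
have phiE : mu phi%:F = mu psi%:F.
  by apply/eqP; rewrite eq_le leNgt -(pol_gtP _ _ phi0) phi_ngt -pol_geP.
exists (1 - w); rewrite dE -phiE -(initial_formE mu phi0) psiE.
by rewrite (mulrBr (initial_form mu phi)) (mulr1 (initial_form mu phi)).
Qed.

Section Augmentation.
Variables (lam : rat) (mu' : extension_valuation v).
Hypothesis lam_gt0 : 0 < lam.
Hypothesis aug : augmentation mu phi lam mu'.

Lemma aug_term (a : {poly K}) s : a != 0 -> (size a < size phi)%N ->
  mu' (a * phi ^+ s)%:F = mu (a * phi ^+ s)%:F + s%:R * lam.
Proof.
move=> a0 a_lt; set c := rcons (nseq s 0) a.
have phi_gt0 := ltnW key_gt1.
have cs n : c`_n = if n == s then a else 0.
  rewrite /c nth_rcons size_nseq nth_nseq.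
  by case: ltngtP.
have cP : all (fun a : {poly K} => size a < size phi)%N c.
  by rewrite all_rcons a_lt all_nseq size_poly0 phi_gt0 orbT.
have E : a * phi ^+ s = \sum_(n < size c) c`_n * phi ^+ n.
  rewrite size_rcons size_nseq big_ord_recr /= cs eqxx big1 ?add0r // => n _.
  by rewrite cs ltn_eqF // mul0r.
have nz : a * phi ^+ s != 0 by rewrite mulf_neq0 // expf_neq0 // key_neq0.
have [[n]] := aug cP E nz; rewrite cs; case: (n =P s) => [->|_]; last by rewrite eqxx.
by move=> _ ->; rewrite ?cs ?eqxx.
Qed.

Lemma aug_small (a : {poly K}) : a != 0 -> (size a < size phi)%N -> mu' a%:F = mu a%:F.
Proof.
by move=> a0 a_lt; have := aug_term 0 a0 a_lt; rewrite expr0 mulr1 mul0r addr0.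
Qed.

Lemma aug_phi : mu' phi%:F = mu phi%:F + lam.
Proof.
have := aug_term 1 (oner_neq0 _); rewrite size_poly1 key_gt1 => /(_ isT).
by rewrite expr1 !mul1r.
Qed.

(** The phi-expansion of a multiple of [phi] has no zeroth term, so each of its terms gains at least
    [lam] > 0. *)
Lemma aug_multiple_gt al q : q * phi \in pol_ge mu al -> q * phi \in pol_gt mu' al.
Proof.
have [->|q0] := eqVneq q 0; first by rewrite mul0r !inE eqxx.
have [c cP qE] := phi_expansion q key_monic key_gt1.
have c'P : all (fun a : {poly K} => size a < size phi)%N (0 :: c).
  by rewrite /= size_poly0 (ltnW key_gt1).
have qphiE : q * phi = \sum_(s < size (0 :: c)) (0 :: c)`_s * phi ^+ s.
  rewrite big_ord_recl /= mul0r add0r {1}qE mulr_suml.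
  by apply: eq_bigr => s _; rewrite /bump /= add1n exprSr mulrA.
have nz : q * phi != 0 by rewrite mulf_neq0 // key_neq0.
move=> qP; rewrite pol_gtP //; have [[s cs ->] _] := aug c'P qphiE nz.
rewrite qphiE in qP; have := key_expansion_ge key_phi c'P qP s.
rewrite pol_geP ?mulf_neq0 ?expf_neq0 ?key_neq0 // => le_al.
case: s cs le_al => [|s] cs le_al; first by rewrite eqxx in cs.
by apply: (le_lt_trans le_al); rewrite ltrDl mulr_gt0 // ltr0Sn.
Qed.

Lemma aug_mod_gt al g : g \in pol_ge mu al -> g - g %% phi \in pol_gt mu' al.
Proof.
move=> gP; have -> : g - g %% phi = g %/ phi * phi by rewrite {1}(divp_eq g phi) addrK.
apply: aug_multiple_gt.
have -> : g %/ phi * phi = g - g %% phi by rewrite {2}(divp_eq g phi) addrK.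
by rewrite pol_geD ?pol_geN ?key_mod_ge.
Qed.

Lemma aug_mod_ge al g : g \in pol_ge mu' al -> g %% phi \in pol_ge mu' al.
Proof.
have [->|g0] := eqVneq g 0; first by rewrite mod0p.
have [->|a0] := eqVneq (g %% phi) 0; first by rewrite pol_ge0.
have a_lt : (size (g %% phi)%R < size phi)%N by rewrite ltn_modp key_neq0.
have [c cP qE] := phi_expansion (g %/ phi) key_monic key_gt1.
have c'P : all (fun a : {poly K} => size a < size phi)%N ((g %% phi) :: c).
  by rewrite /= a_lt.
have gE : g = \sum_(s < size ((g %% phi) :: c)) ((g %% phi) :: c)`_s * phi ^+ s.
  rewrite big_ord_recl /= expr0 mulr1 {1}(divp_eq g phi) addrC; congr (_ + _).
  rewrite {1}qE mulr_suml; apply: eq_bigr => s _.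
  by rewrite /bump /= add1n exprSr mulrA.
have [_ /(_ 0%N a0)] := aug c'P gE g0.
rewrite /= expr0 mulr1 mul0r addr0 -(aug_small a0 a_lt) => le_g.
by rewrite !pol_geP // => /le_trans; apply.
Qed.

(** If the remainder had larger value, [g] would have the same initial form as a multiple of [phi].
    So the remainder keeps the value of [g], and the rest, a multiple of [phi], gains value under
    [mu']. *)
Lemma key_residue g : g != 0 -> ~ gr_dvd mu phi g ->
  [/\ g %% phi != 0, mu (g %% phi)%:F = mu g%:F & mu' g%:F = mu g%:F].
Proof.
move=> g0 ndvd; have gP := pol_ge_val mu g; have dP := key_mod_ge gP.
have qE : g - g %% phi = g %/ phi * phi by rewrite {1}(divp_eq g phi) addrK.
have d_ngt : g %% phi \notin pol_gt mu (mu g%:F).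
  apply/negP => d_gt; apply: ndvd.
  have [|_ _ gE] := initial_form_congr (mu := mu) (g := g) (h := g %/ phi * phi) g0.
    by rewrite -qE subKr.
  exists (initial_form mu (g %/ phi)).
  by rewrite -gE initial_formM (mulrC (initial_form mu phi)).
have d0 : g %% phi != 0 by apply: contraNneq d_ngt => ->; rewrite pol_gt0.
have dE : mu (g %% phi)%:F = mu g%:F.
  by apply/le_anti; rewrite leNgt -pol_gtP // d_ngt -pol_geP.
have d_lt : (size (g %% phi)%R < size phi)%N by rewrite ltn_modp key_neq0.
split=> //; have := aug_mod_gt gP; rewrite -opprB => /pol_gtN; rewrite opprK.
rewrite -{1}dE -(aug_small d0 d_lt) => dg.
have [] // := initial_form_congr d0 dg.
by rewrite (aug_small d0 d_lt) dE.
Qed.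

(** For the product of two small polynomials, primality and minimality show that H(phi) does not
    divide it in Gr(mu), so [key_residue] applies. *)
Lemma aug_division : division_compatible mu' phi.
Proof.
split=> [||al g|a b a0 b0 a_lt b_lt|a]; rewrite ?key_monic ?key_gt1 //.
- exact: aug_mod_ge.
- have ab0 : a * b != 0 by rewrite mulf_neq0.
  have [|d0 dE ->] := key_residue ab0; last by rewrite aug_mod_gt ?pol_ge_val.
  by case/key_prime; exact: key_minimal.
- exact: key_coprime.
Qed.

Lemma key_residue_unit g : g != 0 -> ~ gr_dvd mu phi g ->
  mu' g%:F = mu g%:F /\ small_unit (mu := mu') phi (mu g%:F) (initial_form mu' g).
Proof.
move=> g0 ndvd; have [d0 dE gE] := key_residue g0 ndvd; split=> //.
have d_lt : (size (g %% phi)%R < size phi)%N by rewrite ltn_modp key_neq0.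
have [|_ _ <-] := initial_form_congr (mu := mu') (g := g) (h := g %% phi) g0.
  by rewrite gE aug_mod_gt ?pol_ge_val.
rewrite -dE -(aug_small d0 d_lt).
exact: (small_unit_initial aug_division d0 d_lt).
Qed.
End Augmentation.
End Key.

(** A key polynomial of degree below that of [psi] would have a unit as initial form, whereas it
    generates a proper ideal. Along a chain this makes the degrees non-decreasing. *)
Lemma division_size_le_key psi phi :
  division_compatible mu psi -> key_polynomial mu phi -> (size psi <= size phi)%N.
Proof.
move=> div_psi key_phi; rewrite leqNgt; apply/negP => lt_phi.
have [_ phiU] := small_unit_initial div_psi (key_neq0 key_phi) lt_phi.
exact: (negP (key_not_unit key_phi)).
Qed.

Lemma gauss_division : gauss_valuation mu -> division_compatible mu 'X.
Proof.
move=> gauss.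
have const (a : {poly K}) : (size a < 2)%N -> exists c, a = c%:P.
  by rewrite ltnS => /size1_polyC ->; exists a`_0.
split; rewrite ?monicX ?size_polyX //.
- move=> al g gP; have [->|g0] := eqVneq g 0; first by rewrite mod0p pol_ge0.
  have -> : g %% 'X = (g`_0)%:P.
    have [c cE] : exists c, g %% 'X = c%:P.
      by apply: const; have := ltn_modp g 'X; rewrite size_polyX polyX_eq0 => ->.
    by rewrite {2}(divp_eq g 'X) coefD coefMX add0r cE coefC.
  have [->|c0] := eqVneq g`_0 0; first by rewrite pol_ge0.
  rewrite pol_geP ?polyC_eq0 // vval_base //; have [_ /(_ 0%N c0)] := gauss g g0.
  by apply: le_trans; rewrite -pol_geP.
- move=> a b a0 b0 a_lt b_lt.
  have [[s ->] [t ->]] := (const _ a_lt, const _ b_lt).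
  by rewrite -polyCM modp_small ?subrr ?pol_gt0 // size_polyX ltnS size_polyC leq_b1.
- move=> a a0 a_lt; have [s sE] := const _ a_lt.
  by rewrite sE -alg_polyC coprimepZl ?coprime1p // -polyC_eq0 -sE.
Qed.
End KeyPolynomials.

(** * The data of a MacLane chain *)

Lemma fractionP (R : idomainType) (f : {fraction R}) :
  exists a b, b != 0 /\ f * b%:F = a%:F.
Proof.
elim/quotW: f => f; exists \n_f, \d_f; split; first exact: denom_ratioP.
unlock FracField.tofrac; rewrite -[LHS]FracField.pi_mul; apply/eqmodP.
rewrite /= FracField.equivfE /FracField.mulf !(numer_Ratio, denom_Ratio) ?mulr1 ?oner_neq0
  ?denom_ratioP //.
by rewrite mulrC.
Qed.

Section ValueGroup.
Variables (K : fieldType) (v : discrete_valuation K) (mu : extension_valuation v).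

Lemma vval_fraction f : f != 0 -> exists a b : {poly K},
  [/\ a != 0, b != 0 & mu f = mu a%:F - mu b%:F].
Proof.
move=> f0; have [a [b [b0 fE]]] := fractionP f.
have bF0 : b%:F != 0 by rewrite tofrac_eq0.
have a0 : a != 0.
  by have := mulf_neq0 f0 bF0; rewrite fE tofrac_eq0.
exists a, b; split; [exact: a0 | exact: b0 |].
by rewrite -fE (vvalM mu f0 bF0) addrK.
Qed.

Lemma vram_neq0 : (vram mu)%:R != 0 :> rat.
Proof. by rewrite pnatr_eq0 -lt0n vram_gt0. Qed.

Lemma gauss_vram : gauss_valuation mu -> vram mu = 1%N.
Proof.
move=> gauss.
have int_val (g : {poly K}) : g != 0 -> exists z : int, mu g%:F = z%:~R.
  by move=> /gauss [[s _ ->] _]; exists (v g`_s).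
have [f f0 f1] := vram_surj mu 1.
have [a [b [/int_val [y yE] /int_val [z zE] E]]] := vval_fraction f0.
move: f1; rewrite E yE zE -rmorphB /= -[_%:R]/((vram mu : int)%:~R : rat) -intrM.
move/eqP; rewrite eqr_int => /eqP /(congr1 absz); rewrite abszM => /eqP.
by rewrite muln_eq1 => /andP[/eqP].
Qed.

Lemma gauss_val_X : gauss_valuation mu -> mu ('X)%:F = 0.
Proof.
move=> gauss; have [[s s1 ->] _] := gauss _ (negbT (polyX_eq0 K)).
have v1 : (v 1)%:~R = 0 :> rat by rewrite -(vval_base mu) ?oner_neq0 // tofrac1 vval1.
by move: s1; rewrite coefX; case: (s == 1%N); rewrite ?eqxx.
Qed.

End ValueGroup.

Section Chain.
Variables (K : fieldType) (v : discrete_valuation K) (pi : K).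
Hypothesis pi_unif : uniformizer v pi.
Variables (r : nat) (c : maclane_chain v r).
Local Notation mu := (mac_mu c).
Local Notation phi := (mac_phi c).
Local Notation lam := (mac_lam c).
Local Notation E i := (vram (mac_prev c i)).

Lemma uniformizer_val : v pi = 1.
Proof.
have [a a0 va] := dval_surj v 1.
have /pi_unif [b bO aE] : in_m v a by rewrite /in_m va orbT.
have [pi0 b0] : pi != 0 /\ b != 0.
  by apply/andP; rewrite -negb_or -mulf_eq0 -aE.
have : in_m v pi.
  by apply/pi_unif; exists 1; rewrite ?mulr1 ?(in_O1 c).
move: bO; rewrite /in_m /in_O (negPf pi0) (negPf b0) /= => vb vpi.
by move: va; rewrite aE dvalM //; lia.
Qed.

Lemma mac_division i : (i <= r)%N -> division_compatible (mu i) (phi i).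
Proof.
case: i => [_|i ir]; first by rewrite mac_phi0; apply/gauss_division/mac_mu0.
exact: (@aug_division _ _ _ _ (mac_key c ir) _ _ (mac_lam_gt0 c ir) (@mac_step _ _ _ c _ ir)).
Qed.

(** Augmenting at phi_i leaves the values of polynomials of smaller degree unchanged, so these
    values lie in the value group of mu_{i-1}. *)
Lemma mac_e_int i (a : {poly K}) : (i <= r)%N -> a != 0 -> (size a < size (phi i))%N ->
  exists z : int, (E i)%:R * mu i a%:F = z%:~R.
Proof.
case: i => [_|i ir] a0 a_lt; first by apply: vram_int; rewrite tofrac_eq0.
rewrite (aug_small (mac_key c ir) (@mac_step _ _ _ c _ ir)) //.
by apply: vram_int; rewrite tofrac_eq0.
Qed.

Lemma mac_vram0 : vram (mu 0%N) = 1%N.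
Proof. exact/gauss_vram/mac_mu0. Qed.

Lemma mac_phi_val i : (i < r)%N ->
  mu i.+1 (phi i.+1)%:F = (mac_V c i.+1)%:~R / (E i.+1)%:R + lam i.+1.
Proof.
move=> ir; rewrite (aug_phi (mac_key c ir) (@mac_step _ _ _ c _ ir)); congr (_ + _).
have [|z zE] := @vram_int _ _ (mu i) (phi i.+1)%:F.
  by rewrite tofrac_eq0 (key_neq0 (mac_key c ir)).
by rewrite /mac_V /= zE numq_int -zE mulrAC divff ?mul1r // vram_neq0.
Qed.

Lemma mac_size_mono i : (i < r)%N -> (size (phi i) <= size (phi i.+1))%N.
Proof.
by move=> ir; apply: division_size_le_key (mac_division (ltnW ir)) (mac_key c ir).
Qed.

Lemma mac_pi_unit i : (i <= r)%N ->
  small_unit (mu := mu i) (phi i) 1 (initial_form (mu i) pi%:P).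
Proof.
move=> ir; have pi0 : pi != 0.
  apply/eqP => pi0; have [a a0 va] := dval_surj v 1.
  have /pi_unif [b _ aE] : in_m v a by rewrite /in_m va orbT.
  by rewrite aE pi0 mul0r eqxx in a0.
have -> : 1 = mu i (pi%:P)%:F by rewrite vval_base // uniformizer_val.
apply: (small_unit_initial (mac_division ir)); first by rewrite polyC_eq0.
by have [_ lt _ _ _] := mac_division ir; rewrite size_polyC (leq_ltn_trans _ lt) // leq_b1.
Qed.

Lemma mac_phi_neq0 i : (i <= r)%N -> phi i != 0.
Proof. by case/mac_division => /monic_neq0. Qed.

(* The initial form of [phi_j] stays outside the ideal of [phi_{i+1}] in
   [Gr(mu_i)]: for [j < i] because it is a unit, for [j = i] because
   [phi_{i+1}] and [phi_i] are not equivalent. *)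
Lemma mac_phi_unit i j : (i <= r)%N -> (0 < j < i)%N ->
  mu i (phi j)%:F = mu j (phi j)%:F /\
  small_unit (mu := mu i) (phi i) (mu j (phi j)%:F) (initial_form (mu i) (phi j)).
Proof.
elim: i => [|i IHi] ir; first by rewrite ltn0 andbF.
case/andP=> j0; rewrite ltnS => ji.
have jr : (j <= r)%N := leq_trans ji (ltnW ir).
have res := key_residue_unit (mac_key c ir) (mac_lam_gt0 c ir) (@mac_step _ _ _ c _ ir)
  (mac_phi_neq0 jr).
move: ji; rewrite leq_eqVlt => /orP[/eqP eq_ji|ji].
  rewrite {}eq_ji in j0 res *; apply: res; apply: key_not_dvd_prev.
  - exact: mac_key.
  - by have [] := mac_division (ltnW ir).
  - exact: mac_size_mono.
  - by apply: mac_nequiv; rewrite j0.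
have [|vE [_ phiU]] := IHi (ltnW ir) _; first by rewrite j0.
by rewrite -vE; apply: res => /(unit_not_dvd (mac_key c ir) phiU).
Qed.

(** The unit is an explicit hypothesis because the lemma is applied at earlier indices inside the
    induction that constructs it. A polynomial representing p_i has value 1/e(mu_{i-1}), hence
    e(mu_{i-1}) divides e(mu_i). *)
Lemma mac_index_spec i : (i <= r)%N ->
    small_unit (mu := mu i) (phi i) (E i)%:R^-1 (mac_p pi c i) ->
  [/\ (0 < mac_e c i)%N, vram (mu i) = (mac_e c i * E i)%N,
      (vram (mu i))%:R * lam i = (mac_h c i)%:~R
    & coprimez (mac_h c i) (mac_e c i)].
Proof.
move=> ir [p_small p_unit].
have p0 : mac_p pi c i != 0 by apply: contraTneq p_unit => ->; rewrite unitr0.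
have E0 : (E i)%:R != 0 :> rat := vram_neq0 _.
have [a [a0 _] [aE _]] := small_class_neq0 p_small p0.
have [|z zE] := @vram_int _ _ (mu i) a%:F; first by rewrite tofrac_eq0.
rewrite aE in zE.
have z_vram : z%:~R * (E i)%:R = (vram (mu i))%:R :> rat by rewrite -zE mulfVK.
have vramE : vram (mu i) = (mac_e c i * E i)%N.
  rewrite /mac_e divnK //.
  have /(congr1 absz) : vram (mu i) = z * E i :> int.
    by apply/eqP; rewrite -(eqr_int rat) intrM; apply/eqP; rewrite z_vram.
  by rewrite abszM /= => ->; exact: dvdn_mull.
have e_gt0 : (0 < mac_e c i)%N.
  by have := vram_gt0 (mu i); rewrite vramE muln_gt0 => /andP[].
(* For i = 0 both mu_0(x) and lambda_0 vanish, so V = 0 serves. *)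
have [V VE] : exists V : int, mu i (phi i)%:F = V%:~R / (E i)%:R + lam i.
  case: i ir {p_small p_unit p0 E0 a a0 aE z zE z_vram vramE e_gt0} => [_|i ir].
    exists 0; rewrite mul0r add0r mac_lam0 mac_phi0.
    exact/gauss_val_X/mac_mu0.
  by exists (mac_V c i.+1); exact: mac_phi_val.
have [|y yE] := @vram_int _ _ (mu i) (phi i)%:F.
  by rewrite tofrac_eq0 mac_phi_neq0.
have e_vram : (vram (mu i))%:R = (mac_e c i)%:R * (E i)%:R :> rat by rewrite vramE natrM.
have hE : (vram (mu i))%:R * lam i = (mac_h c i)%:~R.
  suff [h hE] : exists h : int, (vram (mu i))%:R * lam i = h%:~R.
    by rewrite /mac_h hE numq_int.
  exists (y - (mac_e c i)%:Z * V); rewrite rmorphB rmorphM /= -yE VE.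
  by rewrite -pmulrn e_vram; field.
split=> //.
(* The scaled value of [g] is read off from any non-zero term of the expansion of H(g) in powers of
   H(phi_i). Scaled values thus lie in e_i Z + h_i Z, and since they generate Z, a Bezout relation
   results. *)
have poly_val (g : {poly K}) : g != 0 -> exists A B : int,
    (vram (mu i))%:R * mu i g%:F = (mac_e c i)%:R * A%:~R + (mac_h c i)%:~R * B%:~R.
  move=> g0; have [N [w [wP gE]]] := comp_expand (mac_division ir)
    (Gr_component_initial (mu i) g).
  have [n wn] : exists n, w n != 0.
    apply/not_existsP => w0; have /eqP := initial_form_neq0 (mu i) g0; apply.
    rewrite gE big1 // => n _; have /negP := w0 n; rewrite negbK => /eqP ->.
    by rewrite mul0r.
  have [b [b0 b_lt] [bE _]] := small_class_neq0 (wP n) wn.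
  have [j jE] := mac_e_int ir b0 b_lt; exists (j + n%:Z * V), n%:Z.
  rewrite bE in jE; rewrite rmorphD rmorphM /= -jE -hE -!pmulrn VE e_vram.
  by field.
have [f f0 f1] := vram_surj (mu i) 1.
have [a' [b' [/poly_val [A [B aE']] /poly_val [A' [B' bE']] fE]]] := vval_fraction (mu i) f0.
apply/coprimezP; exists (B - B', A - A') => /=.
apply/eqP; rewrite -(eqr_int rat) rmorphD !rmorphM !rmorphB /= -f1 fE mulrBr aE' bE'.
by rewrite -pmulrn; apply/eqP; ring.
Qed.

Lemma mac_bezout i : (0 < mac_e c i)%N -> coprimez (mac_h c i) (mac_e c i) ->
  mac_l c i * mac_h c i + mac_l' c i * (mac_e c i)%:Z = 1.
Proof.
by move=> e_gt0 co; have [] := bezout_pairP 1 co e_gt0.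
Qed.

(** The monomials of stage j are evaluated in Gr(mu_i). The second component is claimed to be a unit
    only for 0 < j < i, the range in which [mac_phi_unit] makes H(phi_j) a unit; the stage pi_1 = pi
    bypasses phi_0 = x. *)
Lemma mac_monomials_unit i j : (j <= i <= r)%N ->
    (forall k, (k < j)%N ->
       small_unit (mu := mu k) (phi k) (E k)%:R^-1 (mac_p pi c k)) ->
  let m := mac_monomials c (initial_form (mu i) pi%:P)
             (fun k => initial_form (mu i) (phi k)) j in
  small_unit (phi i) (E j)%:R^-1 m.1 /\
  ((0 < j < i)%N -> small_unit (phi i) (lam j) m.2).
Proof.
move=> /andP[ji ir] p_unit.
have div_i := mac_division ir.
elim: j ji p_unit => [|j IHj] ji p_unit /=.
  by split=> //; rewrite /mac_prev mac_vram0 invr1; exact: mac_pi_unit.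
have {IHj} [] := IHj (ltnW ji) (fun k kj => p_unit k (ltnW kj)).
case: (mac_monomials c _ _ j) => p F /= pU FU.
have jr : (j < r)%N := leq_trans ji ir.
set p' := if j is 0 then _ else _.
have p'U : small_unit (phi i) (vram (mu j))%:R^-1 p'.
  case: j @p' ji p_unit pU FU jr => [|j] /= ji p_unit pU FU jr.
    by rewrite mac_vram0 invr1; exact: mac_pi_unit.
  have [e_gt0 vramE hE co] := mac_index_spec (ltnW jr) (p_unit _ (ltnSn _)).
  have bez : (mac_l c j.+1)%:~R * (mac_h c j.+1)%:~R
      + (mac_l' c j.+1)%:~R * (mac_e c j.+1)%:R = 1 :> rat.
    by rewrite -[(_)%:R]/((mac_e c j.+1)%:Z%:~R) -!rmorphM -rmorphD mac_bezout.
  have e0 : (mac_e c j.+1)%:R != 0 :> rat by rewrite pnatr_eq0 -lt0n.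
  have E0 : (vram (mu j))%:R != 0 :> rat := vram_neq0 _.
  (* This is the Bezout relation l h + l' e = 1 divided by e(mu_{j+1}); the right side is the degree
     of Phi^l pi^l'. *)
  have -> : (vram (mu j.+1))%:R^-1 =
      (mac_l c j.+1)%:~R * lam j.+1 + (mac_l' c j.+1)%:~R * (E j.+1)%:R^-1.
    have n0 := vram_neq0 (mu j.+1); apply: (mulfI n0).
    rewrite mulfV // mulrDr mulrCA hE vramE natrM -[LHS]bez /mac_prev /=.
    by congr (_ + _); field.
  apply: (small_unitM div_i); apply: (small_unitXz div_i); last exact: pU.
  exact: FU.
split=> // ji'; have [_ phiU] := @mac_phi_unit i j.+1 ir ji'.
have -> : lam j.+1 = mu j.+1 (phi j.+1)%:F + (- mac_V c j.+1)%:~R * (vram (mu j))%:R^-1.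
  by rewrite mac_phi_val // rmorphN mulNr addrAC subrr add0r.
by apply: (small_unitM div_i) => //; exact: (small_unitXz div_i).
Qed.

Lemma mac_p_unit i : (i <= r)%N ->
  small_unit (mu := mu i) (phi i) (E i)%:R^-1 (mac_p pi c i).
Proof.
elim/ltn_ind: i => i IHi ir.
have [|k ki|//] := @mac_monomials_unit i i; first by rewrite leqnn.
by apply: IHi => //; apply: leq_trans (ltnW ki) ir.
Qed.

Lemma mac_x_decomp i : (i <= r)%N ->
  exists2 om, small_unit (mu := mu i) (phi i) (lam i - mu i (phi i)%:F) om
    & mac_x pi c i = initial_form (mu i) (phi i) * om.
Proof.
case: i => [_|i ir].
  exists 1; last by rewrite mulr1.
  rewrite mac_lam0 mac_phi0 gauss_val_X ?subr0; last exact: mac_mu0.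
  by rewrite -(mac_phi0 c); apply: small_unit1; exact: mac_division.
exists (mac_p pi c i.+1 ^ (- mac_V c i.+1)).
  have -> : lam i.+1 - mu i.+1 (phi i.+1)%:F = (- mac_V c i.+1)%:~R * (E i.+1)%:R^-1.
    by rewrite mac_phi_val // opprD addrCA subrr addr0 rmorphN mulNr.
  by apply: (small_unitXz (mac_division ir)); exact: mac_p_unit.
by rewrite /mac_x /mac_p /=; case: (mac_monomials _ _ _ i).
Qed.

(** For i > 0, reducing modulo phi_i changes a polynomial of non-negative mu_{i-1}-value only by
    terms of positive mu_i-value, so its image has a small representative. Conversely both
    valuations agree on small polynomials. For i = 0 the small polynomials are the constants. *)
Lemma mac_F_small_class i (u : Gr (mu i)) : (i <= r)%N ->
  u \in mac_F c i <-> small_class (phi i) 0 u.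
Proof.
case: i u => [|i] u ir; rewrite inE; split.
- case/asboolP => a aO ->; exists a%:P; split=> //.
    by rewrite mac_phi0 size_polyX ltnS size_polyC leq_b1.
  exact: pol_ge_const.
- case=> a [a_lt aP ->]; apply/asboolP.
  rewrite mac_phi0 size_polyX ltnS in a_lt; move: aP; rewrite (size1_polyC a_lt) => aP.
  exists a`_0 => //; move: aP; rewrite inE /in_O polyC_eq0.
  by have [//|a0 /=] := eqVneq a`_0 0; rewrite vval_base // ler0z.
- case/asboolP => _ [g gP ->] ->; rewrite gr_map_class //; last exact: mac_le.
  have dP := key_mod_ge (mac_key c ir) gP.
  have le := val_le_pol_ge (mac_le c ir).
  exists (g %% phi i.+1); split; last 1 first.
  + apply/gr_class_eq; [exact: le|exact: le|].
    exact: (aug_mod_gt (mac_key c ir) (mac_lam_gt0 c ir) (@mac_step _ _ _ c _ ir)).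
  + by rewrite ltn_modp (key_neq0 (mac_key c ir)).
  + exact: le.
- case=> a [a_lt aP ->]; apply/asboolP.
  have aP' : a \in pol_ge (mu i) 0.
    move: aP; rewrite !inE; have [//|a0 /=] := eqVneq a 0.
    by rewrite (aug_small (mac_key c ir) (@mac_step _ _ _ c _ ir)).
  exists (gr_class (mu i) 0 a); first by exists a.
  by rewrite gr_map_class //; exact: mac_le.
Qed.
End Chain.

(** * Presentation by generators and a relation *)

Lemma rmorphism_inverse (R S : nzRingType) (g : {rmorphism R -> S}) :
  injective g -> (forall u, exists t, g t = u) ->
  exists f : {rmorphism S -> R}, cancel f g /\ cancel g f.
Proof.
move=> g_inj /choice [f0 gf]; have fg : cancel g f0 by move=> t; apply: g_inj.
have f_zmod : zmod_morphism f0 by exact: can2_zmod_morphism fg gf.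
have f_mon : monoid_morphism f0 by exact: can2_monoid_morphism fg gf.
pose fA := GRing.isZmodMorphism.Build _ _ f0 f_zmod.
pose fM := GRing.isMonoidMorphism.Build _ _ f0 f_mon.
pose f : {rmorphism S -> R} := HB.pack f0 fA fM.
by exists f.
Qed.

Section Evaluation.
Variables (F : comNzRingType) (A : comUnitRingType) (iota : {rmorphism F -> A}).
Variables (x p : A) (e : nat) (h : int).
Hypothesis p_unit : p \is a GRing.unit.
Hypothesis e_gt0 : (0 < e)%N.

Local Notation L := (galg int {poly F}).
Let y : A := x ^+ e * p ^ (- h).
Let modulus : {poly L} := 'X^e - (gmon h 'X : L)%:P.

(** The innermost of three nested evaluations: in [y], then in powers of [p], then in [x]. In this
    section [e] and [h] are meant as e_r and h_r, and [y] is the element that the relation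
    forces. *)
Definition eval_coef (q : {poly F}) : A := (map_poly iota q).[y].

Lemma eval_coef_is_zmod : zmod_morphism eval_coef.
Proof. by move=> a b; rewrite /eval_coef rmorphB hornerD hornerN. Qed.
Lemma eval_coef_is_monoid : monoid_morphism eval_coef.
Proof. by split=> [|a b]; rewrite /eval_coef ?rmorph1 ?hornerC // rmorphM hornerM. Qed.
HB.instance Definition _ := GRing.isZmodMorphism.Build _ _ eval_coef eval_coef_is_zmod.
HB.instance Definition _ := GRing.isMonoidMorphism.Build _ _ eval_coef eval_coef_is_monoid.

Definition eval_laurent (q : L) : A := \sum_(j <- msupp q) eval_coef (mcoeff j q) * p ^ j.

Lemma eval_laurent_wide (d : seq int) (q : L) : uniq d -> {subset msupp q <= d} ->
  eval_laurent q = \sum_(j <- d) eval_coef (mcoeff j q) * p ^ j.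
Proof.
move=> d_uniq sub; rewrite [RHS](bigID (mem (msupp q))) /= [X in _ + X]big1 ?addr0.
  rewrite -big_filter; apply: perm_big; apply: uniq_perm; rewrite ?fset_uniq ?filter_uniq //.
  by move=> j; rewrite mem_filter; case: (boolP (j \in _)) => // /sub ->.
by move=> j /mcoeff_outdom ->; rewrite rmorph0 mul0r.
Qed.

Lemma eval_laurentU k a : eval_laurent (gmon k a) = eval_coef a * p ^ k.
Proof.
rewrite (@eval_laurent_wide [:: k]) // ?big_seq1 ?mcoeffUU //.
by move=> j /(fsubsetP (msuppU_le (k := k) (x := a))); rewrite !inE.
Qed.

Lemma eval_laurent_is_zmod : zmod_morphism eval_laurent.
Proof.
move=> f g; pose d := undup (msupp f ++ msupp g ++ msupp (f - g)).
have d_uniq : uniq d by exact: undup_uniq.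
rewrite !(@eval_laurent_wide d) //;
  try by move=> j; rewrite mem_undup !mem_cat => ->; rewrite ?orbT.
rewrite -sumrB; apply: eq_bigr => j _.
by rewrite mcoeff_gB rmorphB mulrBl.
Qed.
HB.instance Definition _ := GRing.isZmodMorphism.Build _ _ eval_laurent eval_laurent_is_zmod.

Lemma eval_laurent_is_monoid : monoid_morphism eval_laurent.
Proof.
split=> [|f g]; first by rewrite [1]/(gmon 0 1) eval_laurentU rmorph1 mul1r expr0z.
rewrite (galgE f) mulr_suml !raddf_sum mulr_suml; apply: eq_bigr => k _.
rewrite (galgE g) mulr_sumr !raddf_sum mulr_sumr; apply: eq_bigr => l _.
by rewrite /= gmonM !eval_laurentU rmorphM exprzDr // mulrACA.
Qed.
HB.instance Definition _ := GRing.isMonoidMorphism.Build _ _ eval_laurent eval_laurent_is_monoid.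

Definition eval_poly (q : {poly L}) : A := (map_poly eval_laurent q).[x].

Lemma eval_poly_is_zmod : zmod_morphism eval_poly.
Proof. by move=> a b; rewrite /eval_poly rmorphB hornerD hornerN. Qed.
Lemma eval_poly_is_monoid : monoid_morphism eval_poly.
Proof. by split=> [|a b]; rewrite /eval_poly ?rmorph1 ?hornerC // rmorphM hornerM. Qed.
HB.instance Definition _ := GRing.isZmodMorphism.Build _ _ eval_poly eval_poly_is_zmod.
HB.instance Definition _ := GRing.isMonoidMorphism.Build _ _ eval_poly eval_poly_is_monoid.

Lemma eval_polyC a : eval_poly a%:P = eval_laurent a.
Proof. by rewrite /eval_poly map_polyC hornerC. Qed.

Lemma eval_polyX : eval_poly 'X = x.
Proof. by rewrite /eval_poly map_polyX hornerX. Qed.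

Lemma eval_coefC a : eval_coef a%:P = iota a.
Proof. by rewrite /eval_coef map_polyC hornerC. Qed.

Lemma eval_coefX : eval_coef 'X = y.
Proof. by rewrite /eval_coef map_polyX hornerX. Qed.

Lemma modulus_monic : modulus \is monic.
Proof. by rewrite monicXnsubC. Qed.

Lemma mk_monic_modulus : mk_monic modulus = modulus.
Proof. by rewrite /mk_monic modulus_monic size_XnsubC // ltnS e_gt0. Qed.

Lemma eval_modulus : eval_poly modulus = 0.
Proof.
rewrite rmorphB rmorphXn /= eval_polyX eval_polyC eval_laurentU eval_coefX /y.
by rewrite -mulrA -exprzDr // addNr expr0z mulr1 subrr.
Qed.

Definition eval_target (q : {poly %/ modulus}) : A := eval_poly (val q).

(** The choice of [y] makes [modulus] evaluate to 0, so a polynomial and its remainder have the same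
    image. *)
Lemma eval_target_in_qpoly q : eval_target (in_qpoly modulus q) = eval_poly q.
Proof.
rewrite /eval_target /= mk_monic_modulus.
rewrite {2}(Pdiv.RingMonic.rdivp_eq modulus_monic q).
by rewrite rmorphD rmorphM /= eval_modulus mulr0 add0r.
Qed.

Lemma eval_target_is_zmod : zmod_morphism eval_target.
Proof.
move=> a b; have E : val (a - b) = val a - val b by [].
by rewrite /eval_target E rmorphB.
Qed.
Lemma eval_target_is_monoid : monoid_morphism eval_target.
Proof.
split=> [|a b]; first by rewrite /eval_target /= rmorph1.
have -> : a * b = in_qpoly modulus (val a * val b) by [].
by rewrite eval_target_in_qpoly rmorphM.
Qed.
HB.instance Definition _ := GRing.isZmodMorphism.Build _ _ eval_target eval_target_is_zmod.
HB.instance Definition _ := GRing.isMonoidMorphism.Build _ _ eval_target eval_target_is_monoid.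

Lemma eval_target_surjective :
  (forall u : A, exists s : seq (F * (nat * int)),
     u = \sum_(q <- s) iota q.1 * p ^ q.2.2 * x ^+ q.2.1) ->
  forall u, exists t, eval_target t = u.
Proof.
move=> span u; have [s ->] := span u.
exists (in_qpoly modulus (\sum_(q <- s) (gmon q.2.2 q.1%:P : L)%:P * 'X^(q.2.1))).
rewrite eval_target_in_qpoly raddf_sum; apply: eq_bigr => q _ /=.
by rewrite rmorphM rmorphXn /= eval_polyX eval_polyC eval_laurentU eval_coefC.
Qed.

(** The reduced representative involves x^k only for k < e. Euclidean division of the exponent e i +
    k by e recovers i and k, and then j from j - h i, so distinct monomials have distinct images and
    freeness applies to the coefficients. *)
Lemma eval_target_injective :
  (forall (s : seq (nat * int)) (b : nat * int -> F), uniq s ->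
     \sum_(q <- s) iota (b q) * p ^ q.2 * x ^+ q.1 = 0 ->
     forall q, q \in s -> b q = 0) ->
  injective eval_target.
Proof.
move=> free; apply: raddf_inj => q /= q0; apply/val_inj => /=.
have q_size : (size (val q) <= e)%N.
  have sM : size (mk_monic modulus) = e.+1 by rewrite mk_monic_modulus size_XnsubC.
  by rewrite -ltnS -sM; exact: size_mk_monic.
set Q := val q in q0 q_size *.
(* [J] bounds the exponents of p and [N] the degrees in y uniformly in k, so that the nested sums
   run over one rectangular index set [T]. *)
pose J := undup (flatten [seq (msupp Q`_k : seq int) | k <- index_iota 0 e]).
have suppJ k : (k < e)%N -> {subset msupp Q`_k <= J}.
  move=> ke j jk; rewrite mem_undup; apply/flattenP.
  by exists (msupp Q`_k : seq int) => //; apply/mapP; exists k; rewrite ?mem_index_iota.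
pose N := \max_(k <- index_iota 0 e) \max_(j <- J) size (mcoeff j Q`_k).
have sizeN k j : (k < e)%N -> (size (mcoeff j Q`_k) <= N)%N.
  move=> ke; have [jk|/mcoeff_outdom ->] := boolP (j \in msupp Q`_k); last first.
    by rewrite size_poly0.
  have kI : k \in index_iota 0 e by rewrite mem_index_iota.
  apply: leq_trans (leq_bigmax_seq (F := fun k => \max_(j <- J) size (mcoeff j Q`_k)) k kI isT).
  exact: (leq_bigmax_seq (F := fun j => size (mcoeff j Q`_k)) j (suppJ k ke j jk) isT).
pose T := [seq (k, ji) | k <- index_iota 0 e, ji <- [seq (j, i) | j <- J, i <- index_iota 0 N]].
(* [psi] sends the exponents (k, (j, i)) of x^k p^j y^i to the exponents of x and p in the image;
   [b] inverts it by division by [e] to read off the coefficient. *)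
pose psi (t : nat * (int * nat)) : nat * int := ((e * t.2.2 + t.1)%N, t.2.1 - h * t.2.2).
pose b (t : nat * int) : F := (mcoeff (t.2 + h * (t.1 %/ e)%N) Q`_(t.1 %% e))`_(t.1 %/ e).
have psiK k j i : (k < e)%N ->
    ((psi (k, (j, i))).1 %/ e)%N = i /\ ((psi (k, (j, i))).1 %% e)%N = k.
  by move=> ke; rewrite /psi /= mulnC divnMDl // modnMDl divn_small // modn_small // addn0.
have bE k j i : (k < e)%N -> b (psi (k, (j, i))) = (mcoeff j Q`_k)`_i.
  move=> ke; rewrite /b; have [-> ->] := psiK k j i ke.
  by rewrite /psi /= subrK.
have memT k j i : (k, (j, i)) \in T = [&& (k < e)%N, j \in J & (i < N)%N].
  apply/allpairsP/and3P => [[[k' ji] /= [kI /allpairsP [[j' i'] /= [jJ iI ->]] [-> -> ->]]]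
    |[ke jJ iN]].
    by rewrite !mem_index_iota in kI iI.
  exists (k, (j, i)); split=> //=; first by rewrite mem_index_iota.
  by apply/allpairsP; exists (j, i); rewrite mem_index_iota.
have T_uniq : uniq T.
  apply: allpairs_uniq; rewrite ?iota_uniq //; last by case=> ? [? ?] [? [? ?]].
  by apply: allpairs_uniq; rewrite ?iota_uniq ?undup_uniq //; case=> ? ? [? ?].
have psi_inj : {in T &, injective psi}.
  move=> [k [j i]] [k' [j' i']]; rewrite !memT => /and3P [ke _ _] /and3P [ke' _ _] E.
  have [i1 k1] := psiK k j i ke; have [i2 k2] := psiK k' j' i' ke'.
  rewrite E in i1 k1; rewrite -i1 -k1 i2 k2.
  by move/(congr1 snd): E; rewrite /psi /= -i1 i2 => /addIr ->.
have sum0 : \sum_(t <- map psi T) iota (b t) * p ^ t.2 * x ^+ t.1 = 0.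
  rewrite big_map -[RHS]q0 /eval_target /eval_poly -/Q.
  rewrite (horner_coef_wide _ (n := e)); last exact: leq_trans (size_poly _ _) q_size.
  rewrite big_allpairs big_mkord; apply: eq_bigr => k _ /=.
  rewrite coef_map /= (eval_laurent_wide (undup_uniq _) (suppJ k (ltn_ord k))) mulr_suml.
  rewrite big_allpairs; apply: eq_bigr => j _ /=.
  rewrite /eval_coef (horner_coef_wide _ (n := N)); last first.
    exact: leq_trans (size_poly _ _) (sizeN k j (ltn_ord k)).
  rewrite mulr_suml big_mkord mulr_suml; apply: eq_bigr => i _.
  rewrite coef_map /= bE // /y exprMn exprD exprM exprzDr // -mulNr -exprz_exp -exprnP.
  by move: (p ^ j) (p ^ (- h)) => pj ph; ring.
have T0 := free _ _ _ sum0; rewrite map_inj_in_uniq // in T0.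
apply/polyP => k; rewrite coef0.
have [ek|ke] := leqP e k; first by rewrite nth_default // (leq_trans q_size).
apply/malgP => j; rewrite mcoeff0; apply/polyP => i; rewrite coef0.
have [jk|/mcoeff_outdom ->] := boolP (j \in msupp Q`_k); last by rewrite coef0.
have [iN|Ni] := ltnP i N; last by rewrite nth_default // (leq_trans (sizeN k j ke)).
rewrite -bE //; apply: T0 => //; apply: map_f.
by rewrite memT ke iN (suppJ k ke).
Qed.

Lemma monomial_presentation :
  (forall u : A, exists s : seq (F * (nat * int)),
     u = \sum_(q <- s) iota q.1 * p ^ q.2.2 * x ^+ q.2.1) ->
  (forall (s : seq (nat * int)) (b : nat * int -> F), uniq s ->
     \sum_(q <- s) iota (b q) * p ^ q.2 * x ^+ q.1 = 0 ->
     forall q, q \in s -> b q = 0) ->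
  exists f : {rmorphism A -> {poly %/ modulus}},
    [/\ bijective f, forall a, f (iota a) = in_qpoly modulus (gmon 0 a%:P : L)%:P,
        f x = in_qpoly modulus 'X,
        forall j, f (p ^ j) = in_qpoly modulus (gmon j 1 : L)%:P
      & f (x ^+ e * p ^ (- h)) = in_qpoly modulus (gmon 0 'X : L)%:P].
Proof.
move=> /eval_target_surjective surj /eval_target_injective inj.
have [f [fK gK]] := rmorphism_inverse inj surj.
exists f; split; first (by exists eval_target); move=> *; apply: (can_inj gK).
all: rewrite fK /= eval_target_in_qpoly ?eval_polyX // eval_polyC eval_laurentU.
all: by rewrite ?rmorph1 ?eval_coefC ?eval_coefX ?expr0z ?mulr1 ?mul1r.
Qed.

End Evaluation.

(** * The graded algebra of a MacLane chain *)

(** By coprimality two exponent pairs of the same degree differ by a multiple of (e, -h), the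
    exponents of y. *)
Lemma coprime_pair_shift (h t j : int) (e k s : nat) :
  coprimez h e -> (s < e)%N -> j * e%:Z + k%:Z * h = t * e%:Z + s%:Z * h ->
  exists m : nat, k = (s + e * m)%N /\ j = t - h * m%:Z.
Proof.
move=> co s_lt E.
have dv : (e%:Z %| k%:Z - s%:Z)%Z.
  rewrite -(@Gauss_dvdzl _ _ h) 1?coprimez_sym //; apply/dvdzP; exists (t - j).
  by rewrite mulrBl -[k%:Z * h](addKr (j * e%:Z)) E; ring.
have [q qE] := dvdzP dv.
have e0 : e%:Z != 0 by lia.
(* A negative q would give k = s + q e <= s - e < 0. *)
have q0 : 0 <= q by nia.
exists `|q|%N; have qa : `|q|%N%:Z = q by rewrite gez0_abs.
split; first by nia.
apply: (mulIf e0); rewrite qa.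
have -> : j * e%:Z = t * e%:Z + s%:Z * h - k%:Z * h by rewrite -E addrK.
have -> : k%:Z = q * e%:Z + s%:Z by rewrite -qE subrK.
by ring.
Qed.

Lemma monomial_factor (A : comUnitRingType) (a x p : A) (e s m : nat) (h t : int) :
  p \is a GRing.unit ->
  a * p ^ (t - h * m%:Z) * x ^+ (s + e * m) =
  x ^ s * p ^ t * (a * (x ^+ e * p ^ (- h)) ^+ m).
Proof.
move=> p_unit; rewrite exprzDr // -mulNr -exprz_exp -!exprnP exprD exprM exprMn.
by move: (p ^ t) (p ^ (- h)) => pt ph; ring.
Qed.

Section MacLaneStructure.
Variables (K : fieldType) (v : discrete_valuation K) (pi : K).
Hypothesis pi_unif : uniformizer v pi.
Variables (r : nat) (c : maclane_chain v r).
Local Notation mu := (mac_mu c r).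
Local Notation phi := (mac_phi c r).
Local Notation lam := (mac_lam c r).
Local Notation E := (vram (mac_prev c r)).
Local Notation e := (mac_e c r).
Local Notation h := (mac_h c r).
Local Notation x := (mac_x pi c r).
Local Notation p := (mac_p pi c r).
Local Notation deg := (monomial_degree lam E).

Let div_phi : division_compatible mu phi := mac_division c (leqnn r).
Let p_unit : small_unit phi E%:R^-1 p := mac_p_unit pi_unif c (leqnn r).
Let E_gt0 : (0 < E)%N := vram_gt0 _.
Let e_int (a : {poly K}) := @mac_e_int _ _ _ c r a (leqnn r).

Lemma mac_e_gt0 : (0 < e)%N.
Proof. by have [] := mac_index_spec (leqnn r) p_unit. Qed.

Lemma mac_coprime : coprimez h e.
Proof. by have [] := mac_index_spec (leqnn r) p_unit. Qed.

(** Scaling by e(mu_r) = e_r e(mu_{r-1}) makes degrees integral, so that equal degrees become the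
    integer equation solved by [coprime_pair_shift]. *)
Lemma vram_deg k j : (vram mu)%:R * deg k j = (j * e%:Z + k%:Z * h)%:~R.
Proof.
have [_ vramE hE _] := mac_index_spec (leqnn r) p_unit.
have E0 : E%:R != 0 :> rat := vram_neq0 _.
rewrite rmorphD !rmorphM /= -!pmulrn -hE /monomial_degree vramE natrM.
by field.
Qed.

Lemma mac_monomial_comp (a : Gr mu) k j : small_class phi 0 a ->
  Gr_component (deg k j) (a * p ^ j * x ^+ k).
Proof.
have [om omU xE] := mac_x_decomp pi_unif c (leqnn r).
exact: (monomial_comp div_phi omU xE p_unit).
Qed.

Lemma mac_monomial_span al (u : Gr mu) : Gr_component al u ->
  exists s : seq (Fr c * (nat * int)), (forall q, q \in s -> deg q.2.1 q.2.2 = al) /\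
    u = \sum_(q <- s) Fr_val q.1 * p ^ q.2.2 * x ^+ q.2.1.
Proof.
have [om omU xE] := mac_x_decomp pi_unif c (leqnn r).
move=> /(monomial_span div_phi omU xE E_gt0 p_unit e_int) [s [sP ->]].
exists [seq (insubd (0 : Fr c) q.1, q.2) | q <- s]; split.
  by move=> _ /mapP [q /sP [_ <-] ->].
rewrite big_map big_seq [RHS]big_seq; apply: eq_bigr => q /sP [qF _] /=.
rewrite [Fr_val _]insubdK //; exact/mac_F_small_class.
Qed.

Lemma mac_monomial_free (s : seq (nat * int)) (b : nat * int -> Fr c) : uniq s ->
  \sum_(q <- s) Fr_val (b q) * p ^ q.2 * x ^+ q.1 = 0 ->
  forall q, q \in s -> b q = 0.
Proof.
have [om omU xE] := mac_x_decomp pi_unif c (leqnn r).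
move=> s_uniq b0 q qs; apply: val_inj.
apply: (monomial_free div_phi omU xE E_gt0 p_unit (b := fun q => Fr_val (b q)) s_uniq _ b0 qs).
by move=> t _; apply/mac_F_small_class => //; exact: (valP (b t)).
Qed.

Lemma mac_y_comp : Gr_component 0 (x ^+ e * p ^ (- h)).
Proof.
have := mac_monomial_comp e (- h) (small_class1 div_phi).
rewrite mul1r mulrC; suff -> : deg e (- h) = 0 by [].
apply: (mulfI (vram_neq0 mu)).
by rewrite vram_deg mulNr [_ * h]mulrC addNr mulr0.
Qed.

(** A monomial of degree [al] over F_r has x-exponent s + e m with s the exponent in varphi_r([al]),
    so it is varphi_r([al]) times y^m times an element of F_r, and the last two factors lie in
    Delta. *)
Lemma Gr_component_varphi al (u : Gr mu) : value_group mu al ->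
  Gr_component al u <-> varphi_Delta pi c r al u.
Proof.
case=> f f0 fal; have [n nE] := vram_int mu f0; rewrite fal in nE.
rewrite /varphi_Delta /mac_varphi nE numq_int.
case E_st: (bezout_pair h e n) => [s t].
have [stE s0 s_lt] : [/\ s * h + t * e%:Z = n, 0 <= s & s < e%:Z].
  by move: E_st; rewrite /bezout_pair => -[<- <-]; exact: bezout_pairP mac_coprime mac_e_gt0.
case: s s0 s_lt stE {E_st} => // s _ s_lt stE.
have degE : deg s t = al.
  apply: (mulfI (vram_neq0 mu)); rewrite vram_deg nE.
  by rewrite -stE addrC.
split=> [/mac_monomial_span [w [wP ->]]|[d dP ->]].
  have {wP} [D [DP wE]] : exists D : Fr c * (nat * int) -> Gr mu,
      (forall q, q \in w -> Delta (D q)) /\ forall q, q \in w ->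
      Fr_val q.1 * p ^ q.2.2 * x ^+ q.2.1 = x ^ s * p ^ t * D q.
    suff /choice [D DP] : forall q, exists d : Gr mu, q \in w -> Delta d /\
        Fr_val q.1 * p ^ q.2.2 * x ^+ q.2.1 = x ^ s * p ^ t * d.
      by exists D; split=> q /DP [].
    move=> [a [k j]]; case: (boolP (_ \in w)) => [/wP /= al_deg|_]; last by exists 0.
    have [|m [-> ->]] := @coprime_pair_shift h t j e k s mac_coprime s_lt.
      by apply/eqP; rewrite -(eqr_int rat) -!vram_deg al_deg degE.
    exists (Fr_val a * (x ^+ e * p ^ (- h)) ^+ m) => _; split.
      rewrite /Delta -[0]addr0; apply: Gr_componentM.
        apply: (small_class_comp (phi := phi)); apply/mac_F_small_class => //.
        exact: (valP a).
      by rewrite -(mulr0 m%:R); apply/Gr_componentX/mac_y_comp.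
    have [_ pU] := p_unit.
    exact: monomial_factor.
  exists (\sum_(q <- w) if q \in w then D q else 0).
    by apply: Gr_component_sum => q _; case: ifP => [/DP //|_]; exact: Gr_component0.
  rewrite mulr_sumr [LHS]big_seq [RHS]big_seq; apply: eq_bigr => q qw.
  by rewrite qw wE.
rewrite -degE -[deg s t]addr0; apply: Gr_componentM dP.
have := mac_monomial_comp s t (small_class1 div_phi).
by rewrite mul1r mulrC.
Qed.

Lemma varphi_direct_sum :
  internal_direct_sum (value_group mu) (varphi_Delta pi c r).
Proof.
split=> [u|s w s_uniq wP].
  have [s [w [s_uniq wP uE]]] := Gr_span u.
  (* Gr(mu) is encoded with all rational degrees; those outside the value group are dropped here,
     since their components vanish. *)
  exists [seq al <- s | `[< value_group mu al >]], w; split.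
  - exact: filter_uniq.
  - move=> al; rewrite mem_filter => /andP[/asboolP al_mu _]; split=> //.
    exact/Gr_component_varphi.
  - rewrite big_filter uE (bigID (fun al => `[< value_group mu al >])) /=.
    rewrite [X in _ + X]big1 ?addr0 // => al /asboolPn al_mu.
    apply/eqP/negPn/negP => /(Gr_component_neq0 (wP al)) [g g0 [gal _]].
    by apply: al_mu; exists g%:F => //; rewrite tofrac_eq0.
apply: Gr_direct s_uniq _ => al /wP [al_mu].
by move/(Gr_component_varphi _ al_mu).
Qed.

Lemma Gr_component_target (f : {rmorphism Gr mu -> target c}) : injective f ->
    (forall a : Fr c, f (Fr_val a) = target_scalar a) -> f x = target_x c ->
    (forall j, f (p ^ j) = target_p c j) -> f (x ^+ e * p ^ (- h)) = target_y c ->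
  forall al u, Gr_component al u <-> target_component al (f u).
Proof.
move=> f_inj fa fx fp fy al u.
have fmon (a : Fr c) i k j :
    f (Fr_val a * (x ^+ e * p ^ (- h)) ^+ i * p ^ j * x ^+ k) =
    target_scalar a * target_y c ^+ i * target_p c j * target_x c ^+ k.
  by rewrite !rmorphM !rmorphXn fx fp -fa -fy !rmorphM !rmorphXn.
split=> [/mac_monomial_span [s [sP ->]]|[n [a [i [k [j [degP fuE]]]]]]].
  pose q (t : 'I_(size s)) := tnth (in_tuple s) t.
  (* [target_component] allows any power of x, so the monomials p^j x^k suffice and y gets exponent
     0. *)
  exists (size s), (fun t => (q t).1), (fun=> 0%N), (fun t => (q t).2.1),
    (fun t => (q t).2.2); split.
    by move=> t; apply: sP; exact: mem_tnth.
  rewrite big_tnth rmorph_sum; apply: eq_bigr => t _.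
  by rewrite -fmon expr0 mulr1.
have -> : u = \sum_(t < n) Fr_val (a t) * (x ^+ e * p ^ (- h)) ^+ i t * p ^ j t * x ^+ k t.
  by apply: f_inj; rewrite fuE rmorph_sum; apply: eq_bigr => t _; rewrite fmon.
apply: Gr_component_sum => t _; rewrite -(degP t) -[X in Gr_component X]add0r.
have aP : small_class phi 0 (Fr_val (a t)).
  by apply/mac_F_small_class => //; exact: (valP (a t)).
have := Gr_componentM (mac_monomial_comp (k t) (j t) aP) (Gr_componentX (i t) mac_y_comp).
rewrite mulr0 addr0 add0r => uP.
by rewrite -!mulrA [_ ^+ i t * _]mulrC !mulrA in uP *.
Qed.

Lemma mac_target_isomorphism : exists f : {rmorphism Gr mu -> target c},
  [/\ bijective f, forall a : Fr c, f (Fr_val a) = target_scalar a,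
      f x = target_x c, forall j, f (p ^ j) = target_p c j
    & f (x ^+ e * p ^ (- h)) = target_y c].
Proof.
have [_ pU] := p_unit.
pose iota : {rmorphism Fr c -> Gr mu} := val.
have span (u : Gr mu) : exists s : seq (Fr c * (nat * int)),
    u = \sum_(q <- s) iota q.1 * p ^ q.2.2 * x ^+ q.2.1.
  have [s [w [_ wP ->]]] := Gr_span u.
  elim: s => [|al s [t tE]]; first by exists [::]; rewrite !big_nil.
  have [q [_ qE]] := mac_monomial_span (wP al).
  by exists (q ++ t); rewrite big_cons big_cat /= -tE qE.
have [f fP] := monomial_presentation h pU mac_e_gt0 span mac_monomial_free.
exists f; exact: fP.
Qed.
End MacLaneStructure.

Theorem theorem4p13 (K : fieldType) (v : discrete_valuation K)
    (pi : K) (pi_unif : uniformizer v pi)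
    (r : nat) (c : maclane_chain v r) :
  let mu := mac_mu c r in
  [/\ internal_direct_sum (value_group mu) (varphi_Delta pi c r),
      forall al : rat, value_group mu al ->
        forall u : Gr mu, Gr_component al u <-> varphi_Delta pi c r al u
    & exists f : {rmorphism Gr mu -> target c},
        [/\ bijective f,
            forall (a : Fr c) (u : Gr mu),
              f (Fr_val a * u) = target_scalar a * f u
          & forall (al : rat) (u : Gr mu),
              Gr_component al u <-> target_component al (f u)]].
Proof.
move=> mu; split.
- exact: varphi_direct_sum.
- by move=> al al_mu u; exact: Gr_component_varphi.
- have [f [f_bij fa fx fp fy]] := mac_target_isomorphism pi_unif c.
  exists f; split=> // [a u|]; first by rewrite rmorphM fa.
  exact: (Gr_component_target pi_unif (bij_inj f_bij) fa fx fp fy).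
Qed.
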